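(* Let $\alpha$ and $p$ be real numbers with $-1 < \alpha < -1/2$ and $3/2 + \alpha < p \le 1$. Let $B$ be a Blaschke product with zeros $\{a_n\}_{n\ge 1}$, and suppose that $B' \in A^p_{\alpha}$. Then $$\sum_{n} (1-|a_n|)^{\beta} < \infty$$ for all real $\beta > \frac{2 - p + \alpha}{p - \alpha - 1}$.
   Context: $U$ denotes the open unit disc in $\mathbb{C}$. If $\{a_n\}_{n\ge1}$ is a sequence of complex numbers with $0<|a_n|<1$ for all $n$ and $\sum_{n=1}^\infty (1-|a_n|)<\infty$ (repetitions allowed, according to multiplicity), the Blaschke product with zeros $\{a_n\}$ is the analytic function on $U$ given by $$B(z) = \prod_{n=1}^{\infty} \frac{\bar a_n}{|a_n|}\,\frac{a_n - z}{1-\bar a_n z}.$$ For $0<p<\infty$ and $\alpha>-1$, a function $f$ analytic in $U$ belongs to $A^p_\alpha$ if $$\|f\|_{A^p_\alpha} = \left\{\frac1\pi \iint_U |f(z)|^p (1-|z|)^\alpha\, dA(z)\right\}^{1/p} < \infty,$$ where $dA$ is Lebesgue area measure. *)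

(* Defs.v *)
From HB Require Import structures.
From mathcomp Require Import all_boot all_order all_algebra.
From mathcomp Require Import all_classical all_reals all_analysis.
From mathcomp Require Export complex.

Set Implicit Arguments.
Unset Strict Implicit.
Unset Printing Implicit Defensive.

Import Order.TTheory GRing.Theory Num.Theory numFieldNormedType.Exports.
Import ComplexField.Normc.

Local Open Scope classical_set_scope.
Local Open Scope ring_scope.
Local Open Scope complex_scope.

(* [R[i]^o] is [R[i]] as a normed module over itself, so that [derivable] and
   [derive1] below are complex differentiability and the complex derivative.
   [normc z : R] is the real-valued modulus: [`|z| = (normc z)%:C]. *)

Definition unit_disc (R : realType) : set R[i]^o := [set z | normc z < 1].

Definition analytic_on (R : realType) (D : set R[i]^o) (f : R[i]^o -> R[i]^o)
  : Prop := forall z, D z -> derivable f z 1.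

Definition blaschke_sequence (R : realType) (a : nat -> R[i]^o) : Prop :=
  (forall n, 0 < normc (a n) < 1) /\
  (\sum_(0 <= n <oo) (1 - normc (a n))%:E < +oo)%E.

Definition blaschke_factor (R : realType) (a z : R[i]^o) : R[i]^o :=
  (conjc a / `|a|) * ((a - z) / (1 - conjc a * z)).

(* The zeros are indexed from 0. [limn] is the pointwise limit of the partial
   products. Only the values at points of [unit_disc R] are meaningful. *)
Definition blaschke (R : realType) (a : nat -> R[i]^o) (z : R[i]^o) : R[i]^o :=
  limn (fun N : nat => \prod_(n < N) blaschke_factor (a n) z : R[i]^o).

(* The point [w = (x, y)] of the plane stands for the complex number
   [x + i y]; area is the product of two copies of Lebesgue measure. The value
   is an extended real. *)
Definition bergman_norm (R : realType) (p alpha : R) (f : R[i]^o -> R[i]^o)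
  : \bar R :=
  ((pi^-1)%:E *
   \int[(@lebesgue_measure R \x @lebesgue_measure R)%E]_(w in
       [set w | unit_disc (w.1 +i* w.2)])
     (normc (f (w.1 +i* w.2)) `^ p
      * (1 - normc (w.1 +i* w.2)) `^ alpha)%:E)%E `^ p^-1.

Definition bergman_space (R : realType) (p alpha : R)
  : set (R[i]^o -> R[i]^o) :=
  [set f | analytic_on (@unit_disc R) f /\ (bergman_norm p alpha f < +oo)%E].

(* Main.v *)
Require Import Defs.
From mathcomp Require Import all_boot all_order all_algebra.
From mathcomp Require Import all_classical all_reals all_analysis.
From mathcomp Require Import measurable_realfun ring lra.
Import Order.TTheory GRing.Theory Num.Theory numFieldNormedType.Exports.
Import ComplexField.Normc.
Local Open Scope classical_set_scope.
Local Open Scope ring_scope.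
Local Open Scope complex_scope.

(** Write [s = p - alpha - 1], so that [0 < s < 1] and the exponent in the
    theorem is [(1 - s) / s]. Call [1 - |a n|] the gap of the zero [a n], and
    let [b_n] be its Blaschke factor.

    Reduction to the first power of [B']. The Schwarz-Pick inequality gives
    [|B'| (1 - |z|) <= 1]; as [p <= 1], it follows that
    [|B'| (1 - |z|)^(-s) <= |B'|^p (1 - |z|)^alpha], and the left side has a
    finite area integral [K] ([bergman_mass]).

    Counting. For [d <= 1 / 32] let [N] be the number of zeros, among finitely
    many, whose gap lies between [d / 2] and [d] and which satisfy
    [|Re a| <= Im a]. Suppose that [m > 0] of them have their real part within
    [d] of [x]. On the vertical line through [x], at the depth [d / m] below
    the unit circle, each of these zeros has [1 - |b_n|^2] at least a constant
    over [m]. Hence [|B|] is at most a constant smaller than 1 there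
    ([blaschke_dip]), whereas it is close to 1 near the circle. So the integral
    of [|B'|] over this short segment is bounded below, and the weight
    [(1 - |z|)^(-s)] is at least [(m / d)^s] on it ([vertical_mass_ge]). The
    line through [x] therefore carries a mass of at least a constant times
    [(m / d)^s], and [m^s >= m N^(s - 1)]. Integrating in [x], where each zero
    contributes an interval of length [2 d] to the integral of [m], yields
    [N^s d^(1 - s) <= 300 K] ([counting_bound]): there are at most a constant
    times [d^(- (1 - s) / s)] such zeros.

    Boundary values. That [|B|] is close to 1 near the circle is needed only
    in the mean over [x]. It follows from [1 - |B| <= sum_n (1 - |b_n|^2)],
    where each term is at most the gap times a Poisson kernel, with an integral
    bounded independently of the distance to the circle, and tends to 0 as
    that distance does ([boundary_modulus]).

    Conclusion. Summing [gap^beta] over the dyadic levels [d = 2^-k] gives a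
    geometric series, convergent for [beta > (1 - s) / s]
    ([top_sector_summable]). Quarter turns carry the other three sectors to the
    sector [|Re a| <= Im a] and preserve the area integral ([mass_rotate]). *)

(** * The modulus of a complex number *)
Section Modulus.
Set Implicit Arguments.
Unset Strict Implicit.
Variable R : realType.
Implicit Types (a z w : R[i]) (x y : R).

Lemma normc_sqr z : normc z ^+ 2 = (complex.Re z) ^+ 2 + (complex.Im z) ^+ 2.
Proof. by case: z => x y; rewrite /= sqr_sqrtr // addr_ge0 ?sqr_ge0. Qed.

Lemma normc_ge0 z : 0 <= normc z.
Proof. by case: z => x y; exact: sqrtr_ge0. Qed.

Lemma normc_abs z : `|z| = (normc z)%:C.
Proof. by []. Qed.

Lemma normcD_le z w : normc (z + w) <= normc z + normc w.
Proof. exact: le_normcD. Qed.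

Lemma normc_opp z : normc (- z) = normc z.
Proof. exact: normcN. Qed.

Lemma normcB_sym z w : normc (z - w) = normc (w - z).
Proof. by rewrite -normc_opp opprB. Qed.

Lemma normc_lerB z w : normc z - normc w <= normc (z - w).
Proof. by rewrite lerBlDr -{1}(subrK w z); exact: normcD_le. Qed.

Lemma normc_conj z : normc (conjc z) = normc z.
Proof. by case: z => x y; rewrite /= sqrrN. Qed.

Lemma normcR x : normc x%:C = `|x|.
Proof. by rewrite /= expr0n /= addr0 sqrtr_sqr. Qed.

Lemma normc_Re z : `|complex.Re z| <= normc z.
Proof.
rewrite -[leRHS]ger0_norm ?normc_ge0 // -ler_sqr ?nnegrE ?normr_ge0 //.
by rewrite !real_normK ?num_real // normc_sqr lerDl sqr_ge0.
Qed.

Lemma normc_Im z : `|complex.Im z| <= normc z.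
Proof.
rewrite -[leRHS]ger0_norm ?normc_ge0 // -ler_sqr ?nnegrE ?normr_ge0 //.
by rewrite !real_normK ?num_real // normc_sqr lerDr sqr_ge0.
Qed.

Lemma normc_le_ReIm z : normc z <= `|complex.Re z| + `|complex.Im z|.
Proof.
rewrite -ler_sqr ?nnegrE ?normc_ge0 ?addr_ge0 ?normr_ge0 //.
rewrite normc_sqr sqrrD !real_normK ?num_real //.
by rewrite -addrA lerD2l lerDr mulrn_wge0 // mulr_ge0.
Qed.

Lemma normc_zero : normc (0 : R[i]) = 0. Proof. exact: normc0. Qed.

Lemma normc_one : normc (1 : R[i]) = 1. Proof. exact: normc1. Qed.

Lemma normc_i : normc ('i : R[i]) = 1.
Proof. by rewrite /= expr0n add0r expr1n sqrtr1. Qed.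

Lemma normc_eq0 z : (normc z == 0) = (z == 0).
Proof.
apply/eqP/eqP => [/eq0_normc//|->]; exact: normc0.
Qed.

Lemma normc_gt0 z : (0 < normc z) = (z != 0).
Proof. by rewrite lt_def normc_ge0 andbT normc_eq0. Qed.

End Modulus.

(** * A single Blaschke factor *)
Section Factor.
Set Implicit Arguments.
Unset Strict Implicit.
Variable R : realType.
Implicit Types (a z w : R[i]) (r : R).

Lemma den_ge a z : normc a <= 1 -> 1 - normc z <= normc (1 - conjc a * z).
Proof.
move=> a1; apply: (le_trans _ (normc_lerB _ _)).
rewrite normc_one.
by rewrite lerD2l lerN2 normcM normc_conj ler_piMl // normc_ge0.
Qed.

Lemma den_gt0 a z : normc a <= 1 -> normc z < 1 -> 0 < normc (1 - conjc a * z).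
Proof. by move=> a1 z1; apply: lt_le_trans (den_ge z a1); rewrite subr_gt0. Qed.

Lemma den_neq0 a z : normc a <= 1 -> normc z < 1 -> 1 - conjc a * z != 0.
Proof. by move=> a1 z1; rewrite -normc_gt0 den_gt0. Qed.

(** The identity behind all the estimates on a factor [b]: divided by
    the first term it reads
    [1 - |b z|^2 = (1 - |a|^2) (1 - |z|^2) / |1 - conj a * z|^2]. *)
Lemma mobius_identity a z :
  normc (1 - conjc a * z) ^+ 2 - normc (a - z) ^+ 2 =
  (1 - normc a ^+ 2) * (1 - normc z ^+ 2).
Proof. by rewrite !normc_sqr; case: a z => [a1 a2] [z1 z2] /=; ring. Qed.

(** The normalising constant of a Blaschke factor. The same constant
    serves in [vertical_growth], because multiplying [a] by it gives [|a|]. *)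
Definition unimodular a : R[i] := conjc a / `|a|.

Lemma normc_unimodular a : 0 < normc a -> normc (unimodular a) = 1.
Proof.
move=> a0; rewrite /unimodular normcM normcV normc_conj normc_abs normcR.
by rewrite gtr0_norm // divff // gt_eqF.
Qed.

Lemma unimodularM a : 0 < normc a -> unimodular a * a = `|a|.
Proof.
move=> a0; rewrite /unimodular mulrAC -[conjc a * a]mulrC -sqr_normc expr2 mulfK //.
by rewrite normr_eq0 -normc_gt0.
Qed.

Lemma unimodular_conj a : 0 < normc a -> unimodular a * `|a| = conjc a.
Proof. by move=> a0; rewrite /unimodular divfK // normr_eq0 -normc_gt0. Qed.

Lemma normc_factor a z : 0 < normc a ->
  normc (blaschke_factor a z) = normc (a - z) / normc (1 - conjc a * z).
Proof.
move=> a0; rewrite /blaschke_factor -/(unimodular a) normcM normc_unimodular //.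
by rewrite mul1r normcM normcV.
Qed.

Lemma one_sub_factor_sqr a z : 0 < normc a < 1 -> normc z < 1 ->
  1 - normc (blaschke_factor a z) ^+ 2 =
  (1 - normc a ^+ 2) * (1 - normc z ^+ 2) / normc (1 - conjc a * z) ^+ 2.
Proof.
move=> /andP[a0 a1] z1; have D0 := den_gt0 (ltW a1) z1.
rewrite -mobius_identity normc_factor // expr_div_n mulrBl divff //.
by rewrite sqrf_eq0 gt_eqF.
Qed.

Lemma sqr_lt1 (x : R) : 0 <= x < 1 -> x ^+ 2 < 1.
Proof. by move=> /andP[x0 x1]; rewrite expr_lt1. Qed.

Lemma one_sub_factor_ge0 a z : 0 < normc a < 1 -> normc z < 1 ->
  0 <= 1 - normc (blaschke_factor a z) ^+ 2.
Proof.
move=> a01 z1; rewrite one_sub_factor_sqr // divr_ge0 ?sqr_ge0 //.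
case/andP: a01 => _ a1.
by rewrite mulr_ge0 // subr_ge0 ltW // sqr_lt1 // normc_ge0.
Qed.

Lemma normc_factor_le1 a z : 0 < normc a < 1 -> normc z < 1 ->
  normc (blaschke_factor a z) <= 1.
Proof.
move=> a01 z1; have := one_sub_factor_ge0 a01 z1.
by rewrite subr_ge0 expr_le1 // normc_ge0.
Qed.

(** The right side shows the gap of [a] as a factor, so that a convergent
    sum of gaps makes the infinite product converge. *)
Lemma one_sub_factor a z : 0 < normc a < 1 -> normc z < 1 ->
  1 - blaschke_factor a z =
  (1 - normc a)%:C * (1 + unimodular a * z) / (1 - conjc a * z).
Proof.
move=> /andP[a0 a1] z1; have D0 := den_neq0 (ltW a1) z1.
rewrite /blaschke_factor -/(unimodular a) rmorphB /= -normc_abs.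
have -> : 1 - unimodular a * ((a - z) / (1 - conjc a * z)) =
   ((1 - conjc a * z) - unimodular a * a + unimodular a * z) / (1 - conjc a * z).
  by field.
by rewrite unimodularM // -{1}(unimodular_conj a0); congr (_ / _); ring.
Qed.

Lemma normc_one_sub_factor a z r : 0 < normc a < 1 -> normc z <= r -> r < 1 ->
  normc (1 - blaschke_factor a z) <= 2 / (1 - r) * (1 - normc a).
Proof.
move=> a01 zr r1; have z1 := le_lt_trans zr r1.
rewrite one_sub_factor //; case/andP: a01 => a0 a1.
have d0 : 0 <= 1 - normc a by rewrite subr_ge0 ltW.
rewrite !normcM normcV normcR ger0_norm // -mulrA [leRHS]mulrC ler_wpM2l //.
have h1 : normc (1 + unimodular a * z) <= 2.
  apply: (le_trans (normcD_le _ _)); rewrite normc_one.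
  by rewrite normcM normc_unimodular // mul1r -[2]/(1 + 1) lerD2l ltW.
apply: ler_pM => //; first exact: normc_ge0.
  by rewrite invr_ge0 normc_ge0.
rewrite lef_pV2 ?posrE ?subr_gt0 ?den_gt0 ?(ltW a1) //.
by apply: le_trans (den_ge z (ltW a1)); rewrite lerD2l lerN2.
Qed.

Definition factor_derive a z : R[i] :=
  - unimodular a * (1 - conjc a * a) / (1 - conjc a * z) ^+ 2.

Lemma factor_sub a z w : normc a < 1 -> normc z < 1 -> normc w < 1 ->
  blaschke_factor a w - blaschke_factor a z =
  - unimodular a * (1 - conjc a * a) * (w - z) /
    ((1 - conjc a * w) * (1 - conjc a * z)).
Proof.
move=> a1 z1 w1; have Dz := den_neq0 (ltW a1) z1; have Dw := den_neq0 (ltW a1) w1.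
rewrite /blaschke_factor -/(unimodular a); field.
by rewrite Dz Dw.
Qed.

Lemma factor_taylor a z w : normc a < 1 -> normc z < 1 -> normc w < 1 ->
  blaschke_factor a w - blaschke_factor a z - factor_derive a z * (w - z) =
  - unimodular a * (1 - conjc a * a) * conjc a * (w - z) ^+ 2 /
    ((1 - conjc a * w) * (1 - conjc a * z) ^+ 2).
Proof.
move=> a1 z1 w1; have Dz := den_neq0 (ltW a1) z1; have Dw := den_neq0 (ltW a1) w1.
rewrite /blaschke_factor /factor_derive -/(unimodular a); field.
by rewrite Dz Dw.
Qed.

Lemma normc_one_sub_conjM a : normc a < 1 ->
  normc (1 - conjc a * a) = 1 - normc a ^+ 2.
Proof.
move=> a1.
have -> : 1 - conjc a * a = (1 - normc a ^+ 2)%:C.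
  by rewrite rmorphB rmorph1 rmorphXn /= -normc_abs sqr_normc mulrC.
by rewrite normcR ger0_norm // subr_ge0 ltW // sqr_lt1 // normc_ge0.
Qed.

Lemma one_sub_sqr_le (x : R) : x <= 1 -> 1 - x ^+ 2 <= 2 * (1 - x).
Proof. by move=> x1; have := sqr_ge0 (1 - x); nra. Qed.

Lemma inv_den_le a z r : normc a < 1 -> normc z <= r -> r < 1 ->
  (normc (1 - conjc a * z))^-1 <= (1 - r)^-1.
Proof.
move=> a1 zr r1; rewrite lef_pV2 ?posrE ?subr_gt0 ?den_gt0 ?(ltW a1) //;
  last exact: le_lt_trans r1.
by apply: le_trans (den_ge z (ltW a1)); rewrite lerD2l lerN2.
Qed.

Lemma factor_lipschitz a z w r : 0 < normc a < 1 -> normc z <= r -> normc w <= r ->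
  r < 1 ->
  normc (blaschke_factor a w - blaschke_factor a z) <=
  2 / (1 - r) ^+ 2 * (1 - normc a) * normc (w - z).
Proof.
move=> /andP[a0 a1] zr wr r1.
have z1 := le_lt_trans zr r1; have w1 := le_lt_trans wr r1.
rewrite factor_sub // !(normcM, normcV) normc_opp normc_unimodular // mul1r.
rewrite normc_one_sub_conjM // mulrAC ler_wpM2r ?normc_ge0 //.
have iz := inv_den_le a1 zr r1; have iw := inv_den_le a1 wr r1.
have h := one_sub_sqr_le (ltW a1).
rewrite [leRHS]mulrAC invfM; apply: ler_pM => //.
- by rewrite subr_ge0 ltW // sqr_lt1 // normc_ge0.
- by rewrite mulr_ge0 // invr_ge0 normc_ge0.
- by rewrite -exprVn expr2; apply: ler_pM => //; rewrite invr_ge0 normc_ge0.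
Qed.

Lemma factor_taylor_le a z w r : 0 < normc a < 1 -> normc z <= r -> normc w <= r ->
  r < 1 ->
  normc (blaschke_factor a w - blaschke_factor a z - factor_derive a z * (w - z)) <=
  2 / (1 - r) ^+ 3 * (1 - normc a) * normc (w - z) ^+ 2.
Proof.
move=> /andP[a0 a1] zr wr r1.
have z1 := le_lt_trans zr r1; have w1 := le_lt_trans wr r1.
rewrite factor_taylor // !(normcM, normcV) normc_opp normc_unimodular // mul1r.
rewrite normc_one_sub_conjM // normc_conj mulrAC -expr2 ler_wpM2r ?sqr_ge0 //.
have iz := inv_den_le a1 zr r1; have iw := inv_den_le a1 wr r1.
have h := one_sub_sqr_le (ltW a1).
have A0 : 0 <= 1 - normc a ^+ 2 by rewrite subr_ge0 ltW // sqr_lt1 // normc_ge0.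
rewrite [leRHS]mulrAC !invfM; apply: ler_pM => //.
- by rewrite mulr_ge0 // normc_ge0.
- by rewrite !mulr_ge0 // invr_ge0 normc_ge0.
- by apply: le_trans h; rewrite ler_piMr // ltW.
- apply: ler_pM => //.
  + by rewrite invr_ge0 normc_ge0.
  + by rewrite mulr_ge0 // invr_ge0 normc_ge0.
  + by apply: ler_pM => //; rewrite invr_ge0 normc_ge0.
Qed.

(** A factor is an automorphism of the disc, hence the equality case of
    the Schwarz-Pick inequality. *)
Lemma factor_derive_schwarz_pick a z : 0 < normc a < 1 -> normc z < 1 ->
  normc (factor_derive a z) * (1 - normc z ^+ 2) =
  1 - normc (blaschke_factor a z) ^+ 2.
Proof.
move=> a01 z1; rewrite one_sub_factor_sqr //; case/andP: a01 => a0 a1.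
rewrite /factor_derive !(normcM, normcV) normc_opp normc_unimodular // mul1r.
by rewrite normc_one_sub_conjM // -expr2 mulrAC.
Qed.

Lemma normc_factor_derive_le a z r : 0 < normc a < 1 -> normc z <= r -> r < 1 ->
  normc (factor_derive a z) <= 2 / (1 - r) ^+ 2 * (1 - normc a).
Proof.
move=> /andP[a0 a1] zr r1.
rewrite /factor_derive !(normcM, normcV) normc_opp normc_unimodular // mul1r.
rewrite normc_one_sub_conjM // [leRHS]mulrAC invfM.
have iz := inv_den_le a1 zr r1; have h := one_sub_sqr_le (ltW a1).
apply: ler_pM => //.
- by rewrite subr_ge0 ltW // sqr_lt1 // normc_ge0.
- by rewrite mulr_ge0 // invr_ge0 normc_ge0.
- by rewrite -exprVn expr2; apply: ler_pM => //; rewrite invr_ge0 normc_ge0.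
Qed.

(** The normalising constant [conj a / |a|] absorbs the rotation, so the
    two values are equal and not merely equal in modulus. *)
Lemma factor_rotate a z w : normc w = 1 ->
  blaschke_factor a (w * z) = blaschke_factor (conjc w * a) z.
Proof.
move=> w1; have ww : w * conjc w = 1.
  by rewrite -sqr_normc normc_abs w1 expr1n.
rewrite /blaschke_factor !normc_abs normcM normc_conj w1 mul1r rmorphM /= conjcK.
rewrite (_ : a - w * z = w * (conjc w * a - z)); last first.
  by rewrite mulrBr mulrA ww mul1r.
rewrite (_ : 1 - w * conjc a * z = 1 - conjc a * (w * z)); last by ring.
by ring.
Qed.

End Factor.

(** * Limits of complex sequences *)
Section Convergence.
Set Implicit Arguments.
Unset Strict Implicit.
Variable R : realType.
Implicit Types (u v : nat -> R[i]) (l z w : R[i]).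

(** Convergence in [R[i]] measured by a real error, so that the bounds
    can be handled by real arithmetic. *)
Definition ccvg u l :=
  forall e : R, 0 < e -> exists N, forall n, (N <= n)%N -> normc (u n - l) <= e.

Lemma ccvg_cvg u l : ccvg u l -> (u : nat -> R[i]^o) @ \oo --> (l : R[i]^o).
Proof.
move=> ul; apply/cvgrPdist_le => e e0.
have [x ex] : exists x : R, e = x%:C by apply/complex_realP/gtr0_real.
have {e0} : 0 < x by rewrite -ltcR -ex.
move=> /ul [N uN]; rewrite {}ex; near=> n.
rewrite normc_abs lecR normcB_sym; apply: uN.
by near: n; exact: nbhs_infty_ge.
Unshelve. all: by end_near. Qed.

Lemma ccvg_lim u l : ccvg u l -> limn (u : nat -> R[i]^o) = l.
Proof. by move=> /ccvg_cvg; exact: cvg_lim. Qed.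

Lemma ccvg_le u l w (K : R) : ccvg u l ->
  (forall n, normc (u n - w) <= K) -> normc (l - w) <= K.
Proof.
move=> ul uK; apply/ler_addgt0Pr => e /ul [N uN].
rewrite -(subrK (u N) l) -addrA; apply: (le_trans (normcD_le _ _)).
by rewrite [leRHS]addrC lerD // normcB_sym uN.
Qed.

Lemma ccvgD u v l k : ccvg u l -> ccvg v k -> ccvg (fun n => u n + v n) (l + k).
Proof.
move=> ul vk e e0; have e2 : 0 < e / 2 by rewrite divr_gt0.
have [N uN] := ul _ e2; have [M vM] := vk _ e2.
exists (maxn N M) => n; rewrite geq_max => /andP[Nn Mn].
rewrite opprD addrACA (splitr e); apply: (le_trans (normcD_le _ _)).
by rewrite lerD // ?uN ?vM.
Qed.

Lemma ccvgMr u l w : ccvg u l -> ccvg (fun n => u n * w) (l * w).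
Proof.
move=> ul e e0.
have w0 : 0 < normc w + 1 by rewrite ltr_wpDl // normc_ge0.
have [N uN] := ul _ (divr_gt0 e0 w0); exists N => n Nn.
rewrite -mulrBl normcM; apply: (@le_trans _ _ (e / (normc w + 1) * (normc w + 1))).
  by apply: ler_pM; rewrite ?normc_ge0 ?uN // lerDl.
by rewrite divfK // gt_eqF.
Qed.

Lemma ccvgN u l : ccvg u l -> ccvg (fun n => - u n) (- l).
Proof.
move=> ul e /ul [N uN]; exists N => n Nn.
by rewrite -opprD normc_opp uN.
Qed.

(** Adding to [x] the partial sums of the bounds [e] makes it nondecreasing,
    and those partial sums converge by themselves. *)
Lemma cvg_summable_increments (x : nat -> R) (e : nat -> R) (S : R) :
  (forall n, `|x n.+1 - x n| <= e n) -> (forall N, \sum_(n < N) e n <= S) ->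
  cvgn x.
Proof.
move=> xe eS.
pose E N := \sum_(n < N) e n.
have e0 n : 0 <= e n by apply: le_trans (xe n); exact: normr_ge0.
have cE : cvgn E.
  apply: nondecreasing_is_cvgn.
    by apply/nondecreasing_seqP => n; rewrite /E big_ord_recr /= lerDl.
  by exists S => _ [n _ <-]; exact: eS.
(* only a bound from above is left to prove for [x + E] *)
have xE N : x N - x 0%N <= E N.
  elim: N => [|N IH]; first by rewrite subrr /E big_ord0.
  rewrite /E big_ord_recr /=; have := le_trans (ler_norm _) (xe N).
  by rewrite -/(E N); lra.
have cX : cvgn (fun N => x N + E N).
  apply: nondecreasing_is_cvgn.
    apply/nondecreasing_seqP => n; rewrite /E big_ord_recr /=.
    by have := xe n; rewrite ler_norml => /andP[]; lra.
  exists (S + S + x 0%N) => _ [n _ <-].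
  by have := eS n; have := xE n; rewrite -/(E n); lra.
rewrite (_ : x = (fun N => x N + E N) \- E); first exact: is_cvgB.
by apply/funext => n /=; rewrite addrK.
Qed.

Lemma ccvg_summable_increments u (e : nat -> R) (S : R) :
  (forall n, normc (u n.+1 - u n) <= e n) -> (forall N, \sum_(n < N) e n <= S) ->
  exists l, ccvg u l.
Proof.
move=> ue eS.
have ReB (x y : R[i]) : complex.Re x - complex.Re y = complex.Re (x - y).
  by case: x y => [? ?] [].
have ImB (x y : R[i]) : complex.Im x - complex.Im y = complex.Im (x - y).
  by case: x y => [? ?] [].
have cR : cvgn (fun n => complex.Re (u n)).
  apply: cvg_summable_increments eS => n.
  by rewrite ReB; apply: le_trans (ue n); exact: normc_Re.
have cI : cvgn (fun n => complex.Im (u n)).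
  apply: cvg_summable_increments eS => n.
  by rewrite ImB; apply: le_trans (ue n); exact: normc_Im.
set x := limn _ in cR; set y := limn _ in cI.
exists (x +i* y) => d d0; have e2 : 0 < d / 2 by rewrite divr_gt0.
move/cvgrPdist_le : cR => /(_ _ e2) [N _ hN].
move/cvgrPdist_le : cI => /(_ _ e2) [M _ hM].
exists (maxn N M) => n; rewrite geq_max => /andP[Nn Mn].
apply: (le_trans (normc_le_ReIm _)); rewrite -ReB -ImB /= (splitr d).
by apply: lerD; rewrite distrC; [exact: hN|exact: hM].
Qed.

End Convergence.

(** * Finite Blaschke products *)
Section PartialProducts.
Set Implicit Arguments.
Unset Strict Implicit.
Variable R : realType.
Variable a : nat -> R[i].
Hypothesis a01 : forall n, 0 < normc (a n) < 1.
Implicit Types (z w : R[i]) (r : R) (N n : nat).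

Definition gap n := 1 - normc (a n).

Definition partial_product N z : R[i] := \prod_(n < N) blaschke_factor (a n) z.

Fixpoint partial_derive N z : R[i] :=
  if N is n.+1 then
    partial_derive n z * blaschke_factor (a n) z
    + partial_product n z * factor_derive (a n) z
  else 0.

Let P := partial_product.
Let D := partial_derive.

Lemma gap_gt0 n : 0 < gap n.
Proof. by rewrite subr_gt0; case/andP: (a01 n). Qed.

Lemma gap_lt1 n : gap n < 1.
Proof. by rewrite /gap gtrBl; case/andP: (a01 n). Qed.

Lemma gap_ge0 n : 0 <= gap n. Proof. exact/ltW/gap_gt0. Qed.

Lemma partial_productS N z :
  partial_product N.+1 z = partial_product N z * blaschke_factor (a N) z.
Proof. by rewrite /partial_product big_ord_recr. Qed.

Lemma partial_product_le1 N z : normc z < 1 -> normc (P N z) <= 1.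
Proof.
move=> z1; rewrite /P; elim: N => [|N IH].
  by rewrite /partial_product big_ord0 normc_one.
by rewrite partial_productS normcM mulr_ile1 ?normc_ge0 ?normc_factor_le1.
Qed.

Lemma partial_derive_le N z r : normc z <= r -> r < 1 ->
  normc (D N z) <= 2 / (1 - r) ^+ 2 * \sum_(n < N) gap n.
Proof.
move=> zr r1; have z1 := le_lt_trans zr r1; rewrite /D.
elim: N => [|N IH]; first by rewrite (_ : partial_derive 0 z = 0) // normc_zero big_ord0 mulr0.
rewrite [partial_derive _ _]/= big_ord_recr /= [leRHS]mulrDr.
apply: (le_trans (normcD_le _ _)).
rewrite (normcM (partial_derive N z)) (normcM (partial_product N z)); apply: lerD.
  by apply: le_trans IH; rewrite ler_piMr ?normc_ge0 ?normc_factor_le1.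
apply: le_trans (normc_factor_derive_le (a01 N) zr r1).
by rewrite ler_piMl ?normc_ge0 ?partial_product_le1.
Qed.

(** The bound depends on [N] only through the sum of the gaps, so it
    passes to the infinite product. The inductive step is
    [(F g)(w) - (F g)(z) - (F' g + F g') h = (F w - F z - F' h) g w
    + F z (g w - g z - g' h) + F' h (g w - g z)] with [h = w - z]. *)
Lemma partial_product_taylor N z w r S :
  normc z <= r -> normc w <= r -> r < 1 -> (forall n, \sum_(k < n) gap k <= S) ->
  normc (P N w - P N z - D N z * (w - z)) <=
  (2 / (1 - r) ^+ 3 + (2 / (1 - r) ^+ 2) ^+ 2 * S)
    * (\sum_(n < N) gap n) * normc (w - z) ^+ 2.
Proof.
move=> zr wr r1 gS; rewrite /P /D.
have z1 := le_lt_trans zr r1; have w1 := le_lt_trans wr r1.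
elim: N => [|N IH].
  rewrite (_ : partial_derive 0 z = 0) // /partial_product !big_ord0.
  by rewrite subrr mul0r subr0 normc_zero mulr0 mul0r.
rewrite !partial_productS big_ord_recr /=.
set F := partial_product N; set g := blaschke_factor (a N).
set F' := partial_derive N z; set g' := factor_derive (a N) z.
have -> : F w * g w - F z * g z - (F' * g z + F z * g') * (w - z) =
   (F w - F z - F' * (w - z)) * g w + F z * (g w - g z - g' * (w - z))
   + F' * (w - z) * (g w - g z).
  by ring.
rewrite [X in _ <= X * _]mulrDr [leRHS]mulrDl; apply: (le_trans (normcD_le _ _)).
set C := (_ / _ ^+ 2) in IH *.
set Q := (_ / _ ^+ 3) in IH *.
have C0 : 0 <= C by rewrite divr_ge0 // sqr_ge0.
have -> : (Q + C ^+ 2 * S) * gap N * normc (w - z) ^+ 2 =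
  Q * gap N * normc (w - z) ^+ 2 + (C * S * normc (w - z)) * (C * gap N * normc (w - z)).
  by ring.
rewrite addrA; apply: lerD.
  apply: (le_trans (normcD_le _ _)); apply: lerD.
    apply: le_trans IH; rewrite (normcM (_ - _)).
    by rewrite ler_piMr ?normc_ge0 ?normc_factor_le1.
  apply: le_trans (factor_taylor_le (a01 N) zr wr r1).
  by rewrite (normcM (F z)) ler_piMl ?normc_ge0 ?partial_product_le1.
rewrite (normcM (F' * _)) (normcM F'); apply: ler_pM; rewrite ?mulr_ge0 ?normc_ge0 //.
  rewrite ler_wpM2r ?normc_ge0 //; apply: le_trans (partial_derive_le N zr r1) _.
  by rewrite ler_wpM2l.
exact: factor_lipschitz.
Qed.

Lemma partial_product_step N z r : normc z <= r -> r < 1 ->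
  normc (P N.+1 z - P N z) <= 2 / (1 - r) * gap N.
Proof.
move=> zr r1; have z1 := le_lt_trans zr r1; rewrite /P partial_productS.
rewrite -[X in _ - X]mulr1 -mulrBr (normcM (partial_product N z)) normcB_sym.
apply: le_trans (normc_one_sub_factor (a01 N) zr r1).
by rewrite ler_piMl ?normc_ge0 ?partial_product_le1.
Qed.

Lemma partial_derive_step N z r S : normc z <= r -> r < 1 ->
  (forall n, \sum_(k < n) gap k <= S) ->
  normc (D N.+1 z - D N z) <=
  (2 / (1 - r) ^+ 2 * S * (2 / (1 - r)) + 2 / (1 - r) ^+ 2) * gap N.
Proof.
move=> zr r1 gS; have z1 := le_lt_trans zr r1; rewrite /D /=.
have -> : partial_derive N z * blaschke_factor (a N) z
    + partial_product N z * factor_derive (a N) z - partial_derive N z =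
  partial_derive N z * - (1 - blaschke_factor (a N) z)
    + partial_product N z * factor_derive (a N) z by ring.
apply: (le_trans (normcD_le _ _)).
rewrite (normcM (partial_derive N z)) (normcM (partial_product N z)) normc_opp [leRHS]mulrDl.
apply: lerD.
  rewrite -mulrA; apply: ler_pM; rewrite ?normc_ge0 //.
    apply: le_trans (partial_derive_le N zr r1) _.
    by rewrite ler_wpM2l // divr_ge0 // sqr_ge0.
  exact: normc_one_sub_factor.
apply: le_trans (normc_factor_derive_le (a01 N) zr r1).
by rewrite ler_piMl ?normc_ge0 ?partial_product_le1.
Qed.

(** With [f = |F z|] and [h = |g z|], the product rule reduces the step from
    [F] to [F g] to [h (1 - f^2) + f (1 - h^2) <= 1 - f^2 h^2], that is, to
    [0 <= (1 - f) (1 - h) (1 - f h)]. *)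
Lemma partial_schwarz_pick N z : normc z < 1 ->
  normc (D N z) * (1 - normc z ^+ 2) <= 1 - normc (P N z) ^+ 2.
Proof.
move=> z1; rewrite /D /P; elim: N => [|N IH].
  rewrite (_ : partial_derive 0 z = 0) // /partial_product big_ord0.
  by rewrite normc_zero normc_one expr1n subrr mul0r.
rewrite partial_productS /=; set F := partial_product N z in IH *.
set g := blaschke_factor (a N) z; set F' := partial_derive N z in IH *.
have z2 : 0 <= 1 - normc z ^+ 2 by rewrite subr_ge0 ltW // sqr_lt1 // normc_ge0.
have g1 : normc g <= 1 by apply: normc_factor_le1.
have F1 : normc F <= 1 by apply: partial_product_le1.
have gE := factor_derive_schwarz_pick (a01 N) z1; rewrite -/g in gE.
apply: (@le_trans _ _ ((normc F' * normc g + normc F * normc (factor_derive (a N) z))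
    * (1 - normc z ^+ 2))).
  by rewrite ler_wpM2r // -!normcM normcD_le.
rewrite mulrDl -[X in _ + X]mulrA gE (normcM F) mulrAC.
have := normc_ge0 F; have := normc_ge0 g.
move: (normc F) (normc g) F1 g1 IH => f h f1 h1 IH h0 f0.
have := ler_wpM2r h0 IH.
have : 0 <= (1 - f) * (1 - h) * (1 - f * h).
  by rewrite !mulr_ge0 ?subr_ge0 ?mulr_ile1.
nra.
Qed.

End PartialProducts.

(** * Infinite Blaschke products *)
Section BlaschkeProduct.
Set Implicit Arguments.
Unset Strict Implicit.
Variable R : realType.
Variable a : nat -> R[i]^o.
Hypothesis ha : blaschke_sequence a.
Implicit Types (z w : R[i]^o) (r : R) (N n : nat).

Lemma blaschke_modulus n : 0 < normc (a n) < 1. Proof. by case: ha. Qed.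
Let a01 := blaschke_modulus.

Lemma sum_gap_bounded : exists2 S, 0 <= S & forall N, \sum_(n < N) gap a n <= S.
Proof.
case: ha => _ fin; set T := limn _ in fin.
have T0 : (0 <= T)%E.
  by apply: nneseries_ge0 => n _ _; rewrite lee_fin; exact: (gap_ge0 a01 n).
have Tfin : T \is a fin_num by rewrite ge0_fin_numE.
exists (fine T); first exact: fine_ge0.
move=> N; rewrite -lee_fin fineK // -sumEFin.
rewrite -(big_mkord predT (fun n => (gap a n)%:E)).
by apply: nneseries_lim_ge => n _ _; rewrite lee_fin; exact: (gap_ge0 a01 n).
Qed.

Lemma blaschke_ccvg z : normc z < 1 ->
  ccvg (fun N => partial_product a N z) (blaschke a z).
Proof.
move=> z1; have [S _ gS] := sum_gap_bounded.
have [] := @ccvg_summable_increments R (fun N => partial_product a N z)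
  (fun n => 2 / (1 - normc z) * gap a n) (2 / (1 - normc z) * S).
- by move=> n; exact: partial_product_step.
- move=> N; rewrite -mulr_sumr ler_wpM2l // divr_ge0 // subr_ge0 ltW //.
- by move=> l ul; rewrite /blaschke (ccvg_lim ul).
Qed.

(** [derive1] denotes a limit whether or not that limit exists; a first-order
    expansion with real error terms identifies it. *)
Lemma derive1_ccvg (f : R[i]^o -> R[i]^o) z (D : R[i]^o) :
  (forall e : R, 0 < e -> exists2 d, 0 < d & forall w, normc (w - z) < d ->
     normc (f w - f z - D * (w - z)) <= e * normc (w - z)) ->
  derive1 f z = D.
Proof.
move=> fD; rewrite /derive1; apply: cvg_lim => //.
apply/cvgrPdist_le => e e0.
have [x ex] : exists x : R, e = x%:C by apply/complex_realP/gtr0_real.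
have {e0} : 0 < x by rewrite -ltcR -ex.
move=> /fD [d d0 fd]; rewrite {}ex; near=> h.
have h0 : h != 0 by near: h; exact: nbhs_dnbhs_neq.
have hd : normc h < d.
  rewrite -ltcR -normc_abs; near: h; apply: dnbhs0_lt.
  by rewrite -[0]/(0%:C) ltcR.
have := fd (h + z); rewrite addrK => /(_ hd) fh.
rewrite normc_abs lecR normcB_sym.
have -> : h^-1 *: (f (h + z) - f z) - D = h^-1 * (f (h + z) - f z - D * h).
  by rewrite /GRing.scale /= [RHS]mulrBr [D * h]mulrC mulKf.
rewrite (normcM h^-1) normcV mulrC ler_pdivrMr ?normc_gt0 //.
Unshelve. all: by end_near. Qed.

Lemma partial_derive_ccvg z : normc z < 1 ->
  exists D, ccvg (fun N => partial_derive a N z) D.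
Proof.
move=> z1; have [S S0 gS] := sum_gap_bounded.
apply: (@ccvg_summable_increments R _ _ _ (fun n =>
  partial_derive_step a01 n (lexx (normc z)) z1 gS)) => N.
rewrite -mulr_sumr; apply: ler_wpM2l; last exact: gS.
have z0 : 0 <= 1 - normc z by rewrite subr_ge0 ltW.
by rewrite addr_ge0 ?mulr_ge0 // invr_ge0 // exprn_ge0.
Qed.

Lemma blaschke_taylor_aux z r D : normc z <= r -> r < 1 ->
  ccvg (fun N => partial_derive a N z) D ->
  exists2 K, 0 <= K & forall w, normc w <= r ->
    normc (blaschke a w - blaschke a z - D * (w - z)) <= K * normc (w - z) ^+ 2.
Proof.
move=> zr r1 cD; have [S S0 gS] := sum_gap_bounded.
have z1 := le_lt_trans zr r1.
set C := 2 / (1 - r) ^+ 3 + (2 / (1 - r) ^+ 2) ^+ 2 * S.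
have C0 : 0 <= C.
  by rewrite addr_ge0 ?mulr_ge0 // ?sqr_ge0 // invr_ge0 exprn_ge0 // subr_ge0 ltW.
exists (C * S); first exact: mulr_ge0.
move=> w wr; have w1 := le_lt_trans wr r1.
have cv : ccvg (fun N => partial_product a N w - partial_product a N z
    - partial_derive a N z * (w - z))
    (blaschke a w - blaschke a z - D * (w - z)).
  apply: ccvgD; first apply: ccvgD.
  - exact: blaschke_ccvg.
  - by apply: ccvgN; exact: blaschke_ccvg.
  - by apply: ccvgN; apply: ccvgMr.
rewrite -[X in normc X](subr0 _); apply: (ccvg_le cv) => N; rewrite subr0.
apply: le_trans (partial_product_taylor a01 N zr wr r1 gS) _.
by rewrite ler_wpM2r ?sqr_ge0 // ler_wpM2l.
Qed.

Lemma mid_radius z : normc z < 1 ->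
  [/\ normc z <= (1 + normc z) / 2, (1 + normc z) / 2 < 1 &
   forall w, normc (w - z) < (1 - normc z) / 2 -> normc w <= (1 + normc z) / 2].
Proof.
move=> z1; split; [lra|lra|move=> w wz].
have := normcD_le (w - z) z; rewrite subrK; lra.
Qed.

(** The second-order bound of the partial products survives in the limit,
    so the limit of their derivatives is the derivative of the product. *)
Lemma blaschke_derive z : normc z < 1 ->
  ccvg (fun N => partial_derive a N z) (derive1 (blaschke a) z).
Proof.
move=> z1; have [D cD] := partial_derive_ccvg z1.
suff -> : derive1 (blaschke a) z = D by [].
have [zr r1 wr] := mid_radius z1.
have [K K0 hK] := blaschke_taylor_aux zr r1 cD.
apply: derive1_ccvg => e e0.
have K1 : 0 < K + 1 by rewrite ltr_wpDl.
exists (Num.min ((1 - normc z) / 2) (e / (K + 1))).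
  by rewrite lt_min !divr_gt0 // subr_gt0.
move=> w; rewrite lt_min => /andP[wz we].
apply: le_trans (hK _ (wr _ wz)) _.
rewrite expr2 mulrA ler_wpM2r ?normc_ge0 //.
move: we; rewrite ltr_pdivlMr // mulrDr mulr1 => we.
by have := normc_ge0 (w - z); lra.
Qed.

Lemma blaschke_taylor z : normc z < 1 ->
  exists K d : R, [/\ 0 <= K, 0 < d & forall w, normc (w - z) < d ->
    normc (blaschke a w - blaschke a z - derive1 (blaschke a) z * (w - z))
    <= K * normc (w - z) ^+ 2].
Proof.
move=> z1; have [zr r1 wr] := mid_radius z1.
have [K K0 hK] := blaschke_taylor_aux zr r1 (blaschke_derive z1).
exists K, ((1 - normc z) / 2); split => //; first by rewrite divr_gt0 // subr_gt0.
by move=> w wz; apply: hK; exact: wr.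
Qed.

(** The limit of [partial_schwarz_pick], weakened by
    [1 - |z| <= 1 - |z|^2]. *)
Lemma blaschke_derive_le z : normc z < 1 ->
  normc (derive1 (blaschke a) z) * (1 - normc z) <= 1.
Proof.
move=> z1; have p0 : 0 < 1 - normc z by rewrite subr_gt0.
rewrite -ler_pdivlMr // -[X in normc X]subr0.
apply: (ccvg_le (blaschke_derive z1)) => N; rewrite subr0 ler_pdivlMr //.
have := partial_schwarz_pick a01 N z1.
have := sqr_ge0 (normc (partial_product a N z)).
have := normc_ge0 (partial_derive a N z); have := normc_ge0 z.
by nra.
Qed.

Lemma blaschke_le_partial N z : normc z < 1 ->
  normc (blaschke a z) <= normc (partial_product a N z).
Proof.
move=> z1; apply/ler_addgt0Pr => e e0.
have [M hM] := blaschke_ccvg z1 e0.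
set m := maxn M N.
have dec k : (N <= k)%N ->
    normc (partial_product a k z) <= normc (partial_product a N z).
  elim: k => [|k IH]; first by rewrite leqn0 => /eqP ->.
  rewrite leq_eqVlt => /predU1P[->//|/ltnSE/IH]; apply: le_trans.
  rewrite partial_productS (normcM (partial_product a k z)).
  by rewrite ler_piMr ?normc_ge0 ?normc_factor_le1.
have := hM m (leq_maxl _ _); rewrite normcB_sym => hm.
have := normc_lerB (blaschke a z) (partial_product a m z).
by have := dec m (leq_maxr _ _); lra.
Qed.

Lemma blaschke_le1 z : normc z < 1 -> normc (blaschke a z) <= 1.
Proof.
move=> z1; apply: le_trans (blaschke_le_partial 0 z1) _.
exact: partial_product_le1.
Qed.

(** Nonnegative on the disc; see [mobius_identity] for its size. *)
Definition defect (c z : R[i]) : R := 1 - normc (blaschke_factor c z) ^+ 2.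

(** Each factor obeys [|b|^2 = 1 - defect], and
    [(1 - x) (1 + S + x) <= 1 + S]. A lower bound on the sum of the defects
    over any set of zeros thus keeps [|B|] away from 1. *)
Lemma partial_product_le_inv N z (F : pred nat) : normc z < 1 ->
  normc (partial_product a N z) ^+ 2
    * (1 + \sum_(n < N | F n) defect (a n) z) <= 1.
Proof.
move=> z1; elim: N => [|N IH].
  by rewrite /partial_product !big_ord0 normc_one expr1n addr0 mulr1.
rewrite partial_productS (normcM (partial_product a N z)) exprMn.
rewrite big_mkcond big_ord_recr -big_mkcond /=.
have := one_sub_factor_ge0 (a01 N) z1; rewrite -/(defect (a N) z) => d0.
set x := if _ then _ else _.
have xd : 0 <= x <= defect (a N) z by rewrite /x; case: ifP => _; rewrite ?lexx ?d0.
have -> : normc (blaschke_factor (a N) z) ^+ 2 = 1 - defect (a N) z.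
  by rewrite /defect subKr.
have d1 : defect (a N) z <= 1 by rewrite /defect gerBl sqr_ge0.
set S := \sum_(_ < _ | _) _ in IH *.
have S0 : 0 <= S by apply: sumr_ge0 => n _; exact: one_sub_factor_ge0 (a01 n) z1.
apply: le_trans IH; rewrite -mulrA ler_wpM2l ?sqr_ge0 //.
move: (defect _ _) x xd d0 d1 => q x /andP[x0 xq] q0 q1.
have : (1 - q) * x <= x by rewrite ler_piMl // gerBl.
have : 0 <= q * S by rewrite mulr_ge0.
nra.
Qed.

Lemma one_sub_partial_le N z : normc z < 1 ->
  1 - normc (partial_product a N z) <= \sum_(n < N) defect (a n) z.
Proof.
move=> z1; elim: N => [|N IH].
  by rewrite /partial_product !big_ord0 normc_one subrr.
rewrite partial_productS (normcM (partial_product a N z)) big_ord_recr /=.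
rewrite {2}/defect.
have := partial_product_le1 a01 N z1; have := normc_factor_le1 (a01 N) z1.
have := normc_ge0 (partial_product a N z).
have := normc_ge0 (blaschke_factor (a N) z).
move: (normc (blaschke_factor _ _)) (normc _) IH => g f; nra.
Qed.

Lemma one_sub_blaschke_le z : normc z < 1 ->
  ((1 - normc (blaschke a z))%:E <= \sum_(0 <= n <oo) (defect (a n) z)%:E)%E.
Proof.
move=> z1; apply/lee_addgt0Pr => e e0.
have [M hM] := blaschke_ccvg z1 e0.
apply: (@le_trans _ _ ((\sum_(n < M) defect (a n) z + e)%:E)).
  rewrite lee_fin; have := one_sub_partial_le M z1.
  have := hM M (leqnn _).
  have := normc_lerB (partial_product a M z) (blaschke a z); lra.
rewrite EFinD leeD2r // -sumEFin.
rewrite -(big_mkord predT (fun n => (defect (a n) z)%:E)).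
apply: nneseries_lim_ge => n _ _; rewrite lee_fin.
exact: one_sub_factor_ge0 (a01 n) z1.
Qed.

End BlaschkeProduct.

(** * Growth along vertical segments *)
Section Continuity.
Set Implicit Arguments.
Unset Strict Implicit.
Variable R : realType.
Implicit Types (f : R[i]^o -> R[i]^o) (z w : R[i]^o).

Definition ccontinuous_at f z := forall e : R, 0 < e -> exists2 d, 0 < d &
  forall w, normc (w - z) < d -> normc (f w - f z) < e.

Lemma derivable_ccontinuous f z : derivable f z 1 -> ccontinuous_at f z.
Proof.
rewrite /derivable; set q := fun h => _ => /cvg_ex[l /cvgrPdist_le ql] e e0.
have [x /= x0 hx] : exists2 x : R, 0 < x &
    forall h : R[i], h != 0 -> normc h < x -> normc (l - q h) <= 1.
  have [|d /= d0 hd] := ql 1; first exact: ltr01.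
  have [x dx] : exists x : R, d = x%:C by apply/complex_realP/gtr0_real.
  exists x; first by rewrite -ltcR -dx.
  move=> h h0 hx; rewrite -lecR; apply: (hd h) => //.
  by rewrite /ball_ /= sub0r normrN normc_abs dx ltcR.
have l0 : 0 < normc l + 1 by rewrite ltr_wpDl // normc_ge0.
exists (Num.min x (e / (normc l + 1))); first by rewrite lt_min x0 divr_gt0.
move=> w; rewrite lt_min => /andP[wx we].
have [->|wz] := eqVneq w z; first by rewrite subrr normc_zero.
have wz0 : w - z != 0 by rewrite subr_eq0.
have qE : f w - f z = (w - z) * q (w - z).
  rewrite /q /GRing.scale /= mulr1 subrK mulrA divff ?mul1r //.
rewrite qE normcM mulrC.
have q1 : normc (q (w - z)) <= normc l + 1.
  have := hx _ wz0 wx; have := normc_lerB (q (w - z)) l.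
  by rewrite normcB_sym; lra.
move: we; rewrite ltr_pdivlMr // => we.
apply: le_lt_trans we; rewrite mulrC ler_wpM2l ?normc_ge0 //.
Qed.

Lemma real_taylor_is_derive (g : R -> R) (y h K d : R) : 0 <= K -> 0 < d ->
  (forall t, `|t - y| < d -> `|g t - g y - h * (t - y)| <= K * `|t - y| ^+ 2) ->
  is_derive y 1 g h.
Proof.
move=> K0 d0 gT.
have cv : (fun t => t^-1 *: (g (t *: 1 + y) - g y)) @ 0^' --> h.
  apply/cvgrPdist_le => e e0; near=> t.
  have t0 : t != 0 by near: t; exact: nbhs_dnbhs_neq.
  have td : `|t| < d by near: t; exact: dnbhs0_lt.
  have te : `|t| <= e / (K + 1).
    by near: t; apply: dnbhs0_le; rewrite divr_gt0 // ltr_wpDl.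
  have := gT (t + y); rewrite addrK => /(_ td) gt.
  rewrite distrC {1}/GRing.scale /= scaler1.
  have -> : t^-1 * (g (t + y) - g y) - h = t^-1 * (g (t + y) - g y - h * t).
    by rewrite [RHS]mulrBr [h * t]mulrC mulKf.
  rewrite normrM normfV mulrC ler_pdivrMr ?normr_gt0 //.
  apply: (le_trans gt); rewrite expr2 mulrA ler_wpM2r //.
  move: te; rewrite ler_pdivlMr ?ltr_wpDl // => te.
  by have := normr_ge0 t; nra.
split; first by apply/cvg_ex; exists h.
exact: cvg_lim.
Unshelve. all: by end_near. Qed.

(** For the unimodular [u] with [u * f(top) = |f(top)|], the real function
    [Re (u * f)] grows by at least the left side along the segment, and its
    derivative is at most [|f'|]. *)
Lemma vertical_growth f (x y1 y2 : R) : y1 < y2 ->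
  (forall y, y1 <= y <= y2 -> exists K d : R, [/\ 0 <= K, 0 < d &
    forall w, normc (w - (x +i* y)) < d ->
    normc (f w - f (x +i* y) - derive1 f (x +i* y) * (w - (x +i* y)))
    <= K * normc (w - (x +i* y)) ^+ 2]) ->
  (forall y, y1 <= y <= y2 -> ccontinuous_at (derive1 f) (x +i* y)) ->
  ((normc (f (x +i* y2)) - normc (f (x +i* y1)))%:E <=
   \int[lebesgue_measure]_(y in `[y1, y2]) (normc (derive1 f (x +i* y)))%:E)%E.
Proof.
move=> y12 fT fC.
pose u : R[i] := if f (x +i* y2) == 0 then 1 else unimodular (f (x +i* y2)).
have u1 : normc u = 1.
  rewrite /u; case: ifPn => [_|f0]; first exact: normc_one.
  by rewrite normc_unimodular // normc_gt0.
have uf : complex.Re (u * f (x +i* y2)) = normc (f (x +i* y2)).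
  rewrite /u; case: ifPn => [/eqP ->|f0]; first by rewrite mulr0 normc_zero.
  by rewrite unimodularM ?normc_gt0.
pose g y := complex.Re (u * f (x +i* y)).
pose h y := complex.Re (u * (derive1 f (x +i* y) * 'i)).
have vert (t y : R) : (x +i* t) - (x +i* y) = 'i * (t - y)%:C :> R[i].
  by apply/eqP; rewrite eq_complex /=; apply/andP; split; apply/eqP; ring.
have nvert (t y : R) : normc ((x +i* t) - (x +i* y)) = `|t - y|.
  by rewrite vert (normcM 'i) normcR normc_i mul1r.
have ReB (p q : R[i]) : complex.Re p - complex.Re q = complex.Re (p - q).
  by case: p q => [? ?] [].
have gd y : y1 <= y <= y2 -> is_derive y 1 g (h y).
  move=> /fT [K [d [K0 d0 fTy]]]; apply: (real_taylor_is_derive K0 d0) => t td.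
  have := fTy (x +i* t); rewrite nvert => /(_ td); apply: le_trans.
  have -> : h y * (t - y) = complex.Re (u * (derive1 f (x +i* y) * ('i * (t - y)%:C))).
    rewrite /h; case: (u) (derive1 f _) => [u0 u1'] [v0 v1] /=; ring.
  rewrite /g !ReB -!mulrBr vert.
  by apply: (le_trans (normc_Re _)); rewrite normcM u1 mul1r.
have Rb (v : R[i]) : `|complex.Re (u * (v * 'i))| <= normc v.
  apply: (le_trans (normc_Re _)); rewrite (normcM u) (normcM v) u1 mul1r.
  by rewrite normc_i mulr1.
have Rd (p q : R[i]) :
    `|complex.Re (u * (p * 'i)) - complex.Re (u * (q * 'i))| <= normc (q - p).
  by rewrite ReB -mulrBr -mulrBl normcB_sym; exact: Rb.
have hn y : `|h y| <= normc (derive1 f (x +i* y)).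
  exact: Rb.
have hc y : y1 <= y <= y2 -> {for y, continuous h}.
  move=> /fC fCy; apply/cvgrPdist_lt => e /fCy [d d0 hd].
  near=> t; have := hd (x +i* t); rewrite nvert => /(_ _) ht.
  have td : `|t - y| < d.
    by rewrite distrC; near: t; exact: (@cvgr_dist_lt _ _ _ _ _ id).
  apply: le_lt_trans (ht td); exact: Rd.
have nc y : y1 <= y <= y2 -> {for y, continuous (fun y => normc (derive1 f (x +i* y)))}.
  move=> /fC fCy; apply/cvgrPdist_lt => e /fCy [d d0 hd].
  near=> t; have := hd (x +i* t); rewrite nvert => /(_ _) ht.
  have td : `|t - y| < d.
    by rewrite distrC; near: t; exact: (@cvgr_dist_lt _ _ _ _ _ id).
  apply: le_lt_trans (ht td).
  rewrite ler_norml; apply/andP; split.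
    by rewrite lerNl opprB normc_lerB.
  by rewrite normcB_sym normc_lerB.
have gc y : y1 <= y <= y2 -> {for y, continuous g}.
  by move=> /gd [dg _]; apply: differentiable_continuous; apply/derivable1_diffP.
have FTC : (\int[lebesgue_measure]_(y in `[y1, y2]) (h y)%:E = (g y2)%:E - (g y1)%:E)%E.
  apply: continuous_FTC2 => //.
  - apply: continuous_in_subspaceT => y; rewrite inE /= in_itv /=; exact: hc.
  - split.
    + by move=> y; rewrite in_itv /= => /andP[a b]; have [] := gd y; rewrite ?ltW.
    + by apply: cvg_at_right_filter; apply: gc; rewrite lexx ltW.
    + by apply: cvg_at_left_filter; apply: gc; rewrite lexx ltW.
  - move=> y; rewrite in_itv /= => /andP[a b]; rewrite derive1E.
    by have [] := gd y; rewrite ?ltW.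
apply: (@le_trans _ _ ((g y2)%:E - (g y1)%:E)%E).
  rewrite -EFinB lee_fin /g uf lerD2l lerN2.
  apply: (le_trans (ler_norm _)); apply: (le_trans (normc_Re _)).
  by rewrite normcM u1 mul1r.
have sub : measurable (`[y1, y2] : set R) by exact: measurable_itv.
rewrite -FTC; apply: le_integral => //.
- apply: continuous_compact_integrable; first exact: segment_compact.
  by apply: continuous_in_subspaceT => y; rewrite inE /= in_itv /=; exact: hc.
- apply: continuous_compact_integrable; first exact: segment_compact.
  by apply: continuous_in_subspaceT => y; rewrite inE /= in_itv /=; exact: nc.
- by move=> y _; rewrite lee_fin; apply: le_trans (hn y); exact: ler_norm.
Unshelve. all: by end_near. Qed.

End Continuity.

(** * Blaschke factors just below the upper arc of the unit circle *)
Section Geometry.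
Set Implicit Arguments.
Unset Strict Implicit.
Variable R : realType.
Implicit Types (a z w : R[i]) (x y t d e u v : R).

(** The ordinate of the upper unit semicircle above the abscissa [x]. *)
Definition arc x := Num.sqrt (1 - x ^+ 2).

Definition below x t : R[i] := x +i* (arc x - t).

Lemma arc_sqr x : `|x| <= 3 / 4 -> arc x ^+ 2 = 1 - x ^+ 2.
Proof.
rewrite ler_norml => /andP[x1 x2]; rewrite /arc sqr_sqrtr // subr_ge0.
by nra.
Qed.

Lemma arc_ge x : `|x| <= 3 / 4 -> 5 / 8 <= arc x.
Proof.
move=> x34; rewrite -(@ler_sqr R) ?nnegrE ?sqrtr_ge0 ?arc_sqr //.
by move: x34; rewrite ler_norml => /andP[x1 x2]; nra.
Qed.

Lemma arc_le1 x : `|x| <= 3 / 4 -> arc x <= 1.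
Proof.
move=> x34; rewrite -(@ler_sqr R) ?nnegrE ?sqrtr_ge0 ?arc_sqr ?expr1n //.
by rewrite gerBl sqr_ge0.
Qed.

Lemma one_sub_below_sqr x t : `|x| <= 3 / 4 ->
  1 - normc (below x t) ^+ 2 = 2 * arc x * t - t ^+ 2.
Proof.
move=> x34; rewrite normc_sqr /=; have := arc_sqr x34.
by move: (arc x) => h hE; have -> : x ^+ 2 = 1 - h ^+ 2; [rewrite hE; ring|ring].
Qed.

Lemma one_sub_below_sqr_bounds x t : `|x| <= 3 / 4 -> 0 < t <= 1 / 32 ->
  t <= 1 - normc (below x t) ^+ 2 <= 2 * t.
Proof.
move=> x34 /andP[t0 t1]; rewrite one_sub_below_sqr //.
have := arc_ge x34; have := arc_le1 x34; move: (arc x) => h h1 h2.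
by apply/andP; split; nra.
Qed.

Lemma below_lt1 x t : `|x| <= 3 / 4 -> 0 < t <= 1 / 32 -> normc (below x t) < 1.
Proof.
move=> x34 t01; have /andP[+ _] := one_sub_below_sqr_bounds x34 t01.
case/andP: t01 => t0 t1; have := normc_ge0 (below x t).
move: (normc _) => m; nra.
Qed.

Lemma one_sub_below_le x t : `|x| <= 3 / 4 -> 0 < t <= 1 / 32 ->
  1 - normc (below x t) <= t.
Proof.
move=> x34 /andP[t0 t1]; have := one_sub_below_sqr t x34.
have := normc_ge0 (below x t); have := arc_le1 x34.
move: (normc _) (arc x) => m h h1 m0 mE.
have t0' : 0 <= 1 - t by lra.
suff : 1 - t <= m by lra.
by rewrite -ler_sqr ?nnegrE //; nra.
Qed.

(** [5 / 7] is a rational upper bound for [1 / sqrt 2]. It leaves the room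
    [3 / 4 - 5 / 7 > 1 / 32] used in [integral_close]. *)
Lemma top_sector_Re_le (u v : R) : `|u| <= v -> u ^+ 2 + v ^+ 2 <= 1 -> `|u| <= 5 / 7.
Proof.
move=> uv h; rewrite -ler_sqr ?nnegrE ?normr_ge0 //.
have : `|u| ^+ 2 = u ^+ 2 by rewrite real_normK ?num_real.
by have := normr_ge0 u; move: (`|u|) uv => m; nra.
Qed.

(** Write [1 - conj a * z = (1 - |a|^2) + conj a * (a - z)]. The first term is
    at most [2 d]. In the second, the abscissas differ by at most [d]; the
    ordinates differ by a multiple of [d] because both points lie within a
    multiple of [d] of the upper arc, whose slope is bounded over
    [|x| <= 3 / 4]. *)
Lemma normc_den_below_le a x t d : normc a < 1 -> 1 - normc a <= d ->
  0 < t <= d -> d <= 1 / 32 -> `|complex.Re a| <= complex.Im a ->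
  `|x - complex.Re a| <= d -> `|x| <= 3 / 4 ->
  normc (1 - conjc a * below x t) <= 12 * d.
Proof.
move=> a1 ad /andP[t0 td] d32 sec xu x34.
have -> : 1 - conjc a * below x t = (1 - conjc a * a) + conjc a * (a - below x t) by ring.
apply: (le_trans (normcD_le _ _)).
rewrite normc_one_sub_conjM // (normcM (conjc a)) normc_conj.
have h1 := one_sub_sqr_le (ltW a1).
have h2 : normc a * normc (a - below x t) <= normc (a - below x t).
  by rewrite ler_piMl ?normc_ge0 // ltW.
have := normc_le_ReIm (a - below x t).
have an := normc_sqr a; have n0 := normc_ge0 a.
move: (normc (a - below x t)) h2 => m h2.
case: a a1 ad sec xu an n0 h1 h2 => u v /=.
move: (Num.sqrt _) => na a1 ad sec xu an n0 h1 h2 hm.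
have u57 : `|u| <= 5 / 7.
  apply: (top_sector_Re_le sec); rewrite -an; nra.
have hE := arc_sqr x34; have h58 := arc_ge x34.
rewrite distrC in xu.
have vh : `|v - arc x| <= 7 * d.
  have v0 : 0 <= v by apply: le_trans sec; exact: normr_ge0.
  have k1 : `|v - arc x| * (v + arc x) <= 4 * d.
    rewrite -[X in _ * X]ger0_norm ?addr_ge0 ?sqrtr_ge0 // -normrM.
    have -> : (v - arc x) * (v + arc x) = (na ^+ 2 - 1) + (x - u) * (x + u).
      by rewrite an -subr_sqr -subr_sqr hE; ring.
    apply: (le_trans (ler_normD _ _)); rewrite normrM distrC.
    have q0 : 0 <= 1 - na ^+ 2 by rewrite subr_ge0 ltW // sqr_lt1 // n0.
    rewrite (ger0_norm q0).
    have xu2 : `|x + u| <= 2.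
      by apply: (le_trans (ler_normD _ _)); lra.
    have : `|x - u| * `|x + u| <= d * 2.
      by apply: ler_pM => //; rewrite distrC.
    by lra.
  have := normr_ge0 (v - arc x); move: (`|v - arc x|) k1 => k k1 k0.
  by nra.
have : `|v - (arc x - t)| <= 7 * d + t.
  rewrite opprB addrA addrAC; apply: (le_trans (ler_normD _ _)).
  by rewrite lerD // ger0_norm // ltW.
by nra.
Qed.

(** The numerator of the defect is at least of order [d * t], and its
    denominator at most of order [d^2]. *)
Lemma defect_lower a x t d : 0 < normc a < 1 -> d / 2 < 1 - normc a <= d ->
  0 < t <= d -> d <= 1 / 32 -> `|complex.Re a| <= complex.Im a ->
  `|x - complex.Re a| <= d -> `|x| <= 3 / 4 ->
  t / (288 * d) <= defect a (below x t).
Proof.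
move=> a01 /andP[da ad] td d32 sec xu x34; have /andP[a0 a1] := a01.
have t32 : 0 < t <= 1 / 32 by case/andP: td => -> td; exact: le_trans d32.
have z1 := below_lt1 x34 t32.
rewrite /defect one_sub_factor_sqr // ler_pdivlMr ?exprn_gt0 ?den_gt0 ?(ltW a1) //.
have hd := normc_den_below_le a1 ad td d32 sec xu x34.
have /andP[zt _] := one_sub_below_sqr_bounds x34 t32.
have /andP[t0 td'] := td; have d0 := lt_le_trans t0 td'.
have hd2 : normc (1 - conjc a * below x t) ^+ 2 <= (12 * d) ^+ 2.
  by rewrite ler_sqr // ?nnegrE ?normc_ge0 //; lra.
apply: (@le_trans _ _ (t / (288 * d) * (12 * d) ^+ 2)).
  apply: ler_wpM2l hd2; apply: divr_ge0; first exact: ltW.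
  by apply: mulr_ge0; [exact: ler0n|exact: ltW].
have -> : t / (288 * d) * (12 * d) ^+ 2 = d / 2 * t.
  by field; rewrite gt_eqF.
apply: ler_pM => //; [lra|lra|].
by apply: (le_trans (ltW da)); rewrite lerD2l lerN2 expr2 ler_piMr // ltW.
Qed.

Lemma defect_upper_gap a x e : 0 < normc a < 1 -> 0 < e <= 1 / 32 ->
  `|x| <= 3 / 4 -> defect a (below x e) <= 4 * e / (1 - normc a).
Proof.
move=> a01 e32 x34; have /andP[a0 a1] := a01.
have z1 := below_lt1 x34 e32.
rewrite /defect one_sub_factor_sqr // ler_pdivrMr ?exprn_gt0 ?den_gt0 ?(ltW a1) //.
have /andP[_ ze] := one_sub_below_sqr_bounds x34 e32.
have h1 := one_sub_sqr_le (ltW a1).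
have g0 : 0 < 1 - normc a by rewrite subr_gt0.
have hd : 1 - normc a <= normc (1 - conjc a * below x e).
  have := normc_lerB 1 (conjc a * below x e); rewrite normc_one; apply: le_trans.
  by rewrite lerD2l lerN2 (normcM (conjc a)) normc_conj ler_piMr ?ltW.
apply: (@le_trans _ _ (4 * e / (1 - normc a) * (1 - normc a) ^+ 2)); last first.
  rewrite ler_wpM2l //; last by rewrite ler_sqr // ?nnegrE ?normc_ge0 // ltW.
  by case/andP: e32 => e0 _; rewrite divr_ge0 ?ltW // mulr_gt0.
have -> : 4 * e / (1 - normc a) * (1 - normc a) ^+ 2 = (2 * (1 - normc a)) * (2 * e).
  by field; rewrite gt_eqF.
apply: ler_pM => //.
  by rewrite subr_ge0 ltW // sqr_lt1 // normc_ge0.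
by rewrite subr_ge0 ltW // sqr_lt1 // normc_ge0.
Qed.

(** Both [1 - |z|] and [|a - z|] bound [|1 - conj a * z|] from below, so the
    denominator is at least of order [e^2 + (x - Re a)^2]. The gap is thus
    multiplied by a Poisson kernel, with an integral in [x] bounded uniformly
    in [e]. *)
Lemma defect_upper_poisson a x e : 0 < normc a < 1 -> 0 < e <= 1 / 32 ->
  `|x| <= 3 / 4 ->
  defect a (below x e) <=
  32 * (1 - normc a) * (e / (e ^+ 2 + (x - complex.Re a) ^+ 2)).
Proof.
move=> a01 e32 x34; have /andP[a0 a1] := a01.
have z1 := below_lt1 x34 e32; have /andP[e0 _] := e32.
rewrite /defect one_sub_factor_sqr // ler_pdivrMr ?exprn_gt0 ?den_gt0 ?(ltW a1) //.
have /andP[ez ze] := one_sub_below_sqr_bounds x34 e32.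
have h1 := one_sub_sqr_le (ltW a1).
have g0 : 0 < 1 - normc a by rewrite subr_gt0.
have hA : e / 2 <= normc (1 - conjc a * below x e).
  apply: le_trans (den_ge _ (ltW a1)); have := one_sub_sqr_le (ltW z1); lra.
have hB : (x - complex.Re a) ^+ 2 <= normc (1 - conjc a * below x e) ^+ 2.
  apply: (@le_trans _ _ (normc (a - below x e) ^+ 2)).
    rewrite normc_sqr; case: (a) => u v /=; rewrite -sqrrN opprB lerDl.
    exact: sqr_ge0.
  rewrite -subr_ge0 mobius_identity mulr_ge0 // subr_ge0 ltW // sqr_lt1 // normc_ge0 //.
have hA2 : (e / 2) ^+ 2 <= normc (1 - conjc a * below x e) ^+ 2.
  by rewrite ler_sqr // ?nnegrE ?normc_ge0 // divr_ge0 // ltW.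
set W := (x - _) ^+ 2 in hB *; have W0 : 0 <= W by exact: sqr_ge0.
have eW : 0 < e ^+ 2 + W by rewrite ltr_wpDr // exprn_gt0.
set Q := normc (1 - _) ^+ 2 in hB hA2 *.
have hQ : (e ^+ 2 + W) / 8 <= Q by move: hB hA2; rewrite expr_div_n; nra.
apply: (@le_trans _ _ (32 * (1 - normc a) * (e / (e ^+ 2 + W)) * ((e ^+ 2 + W) / 8))); last first.
  by rewrite ler_wpM2l // !mulr_ge0 ?invr_ge0 // ltW.
have -> : 32 * (1 - normc a) * (e / (e ^+ 2 + W)) * ((e ^+ 2 + W) / 8)
   = (2 * (1 - normc a)) * (2 * e).
  by field; rewrite gt_eqF.
apply: ler_pM => //.
  by rewrite subr_ge0 ltW // sqr_lt1 // normc_ge0.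
by rewrite subr_ge0 ltW // sqr_lt1 // normc_ge0.
Qed.

Lemma continuous_poisson (u e : R) : 0 < e ->
  continuous (fun x => e / (e ^+ 2 + (x - u) ^+ 2)).
Proof.
move=> e0 x; apply: cvgM; first exact: cvg_cst.
apply: cvgV; first by rewrite gt_eqF // ltr_wpDr ?sqr_ge0 // exprn_gt0.
apply: cvgD; first exact: cvg_cst.
apply: (@cvg_comp _ _ _ (fun x => x - u) (fun y => y ^+ 2)); last exact: exprn_continuous.
by apply: cvgB; [exact: cvg_id|exact: cvg_cst].
Qed.

Lemma integral_poisson_le u e : 0 < e ->
  (\int[lebesgue_measure]_(x in `[(- (3 / 4))%R, (3 / 4)%R]) (e / (e ^+ 2 + (x - u) ^+ 2))%:E
   <= (pi : R)%:E)%E.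
Proof.
move=> e0.
pose F x := atan ((x - u) / e).
have den x : e ^+ 2 + (x - u) ^+ 2 != 0.
  by rewrite gt_eqF // ltr_wpDr ?sqr_ge0 // exprn_gt0.
have Fd x : is_derive x 1 F (e / (e ^+ 2 + (x - u) ^+ 2)).
  have h : is_derive x 1 (fun x => (x - u) / e) (e^-1).
    have -> : (fun x => (x - u) / e) = (fun x => e^-1 *: (x - u)).
      by apply/funext => y; rewrite mulrC.
    by apply: is_derive_eq; rewrite subr0 /GRing.scale /= mulr1.
  apply: is_derive_eq; rewrite /GRing.scale /=.
  have e1 : e != 0 by rewrite gt_eqF.
  by field; rewrite den e1.
have cF : continuous F.
  by move=> x; have [d _] := Fd x; apply/differentiable_continuous/derivable1_diffP.
rewrite (@continuous_FTC2 _ _ F).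
- rewrite -EFinB lee_fin /F.
  have := @atan_ltpi2 R ((3 / 4 - u) / e); have := @atan_gtNpi2 R ((- (3 / 4) - u) / e).
  by lra.
- by lra.
- by apply: continuous_in_subspaceT => x _; exact: continuous_poisson.
- split.
  + by move=> x _; have [] := Fd x.
  + by apply: cvg_at_right_filter; exact: cF.
  + by apply: cvg_at_left_filter; exact: cF.
- by move=> x _; rewrite derive1E; have [] := Fd x.
Qed.

End Geometry.

(** * Measurable functions on the plane *)
Section PlanarMeasurability.
Set Implicit Arguments.
Unset Strict Implicit.
Variable R : realType.

(** An open set is the countable union of the boxes with rational centre and
    radius [1 / n] that it contains. *)
Lemma planar_open_measurable (S : set (R * R)) :
  (forall w, S w -> exists2 e : R, 0 < e & forall w' : R * R,
     `|w'.1 - w.1| < e -> `|w'.2 - w.2| < e -> S w') ->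
  measurable S.
Proof.
move=> oS.
pose box (q : rat * rat * nat) : set (R * R) :=
  ball (ratr q.1.1 : R) (q.2.+1%:R^-1) `*` ball (ratr q.1.2 : R) (q.2.+1%:R^-1).
have -> : S = \bigcup_q (if `[< box q `<=` S >] then box q else set0).
  apply/seteqP; split => [w Sw|w [q _]]; last by case: asboolP => // + bw; exact.
  have [e e0 he] := oS w Sw.
  have [n ne] : exists n : nat, n.+1%:R^-1 < e / 2.
    have e2 : 0 < e / 2 by rewrite divr_gt0.
    exists (Num.trunc (e / 2)^-1); rewrite invf_plt ?posrE //.
    exact: truncnS_gt.
  have n0 : 0 < n.+1%:R^-1 :> R by rewrite invr_gt0.
  set dl := n.+1%:R^-1 in ne n0.
  have [q1 /andP[q1l q1r]] : exists q, (w.1 < ratr q < w.1 + dl).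
    have [q] := @rat_in_itvoo R w.1 (w.1 + dl) (ltr_pwDr n0 (lexx _)).
    by rewrite in_itv /= => ?; exists q.
  have [q2 /andP[q2l q2r]] : exists q, (w.2 < ratr q < w.2 + dl).
    have [q] := @rat_in_itvoo R w.2 (w.2 + dl) (ltr_pwDr n0 (lexx _)).
    by rewrite in_itv /= => ?; exists q.
  exists (q1, q2, n) => //; case: asboolP => [_|[]].
    split; rewrite /ball /= /ball_ /= ltr_norml; apply/andP; split; rewrite -/dl.
  1-4: lra.
  move=> w' [/= b1 b2]; apply: he.
    move: b1; rewrite /ball /= /ball_ /= -/dl !ltr_norml => /andP[? ?].
    by apply/andP; split; lra.
  move: b2; rewrite /ball /= /ball_ /= -/dl !ltr_norml => /andP[? ?].
  by apply/andP; split; lra.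
apply: countable_bigcupT_measurable; first exact: countableP.
move=> q; case: asboolP => _; last exact: measurable0.
by apply: measurableX; exact: measurable_ball.
Qed.

Lemma planar_lsc_measurable (g : R * R -> R) :
  (forall w c, c < g w -> exists2 e : R, 0 < e & forall w' : R * R,
     `|w'.1 - w.1| < e -> `|w'.2 - w.2| < e -> c < g w') ->
  measurable_fun setT g.
Proof.
move=> hg; apply: (measurability _ (RGenOInfty.measurableE R)).
move=> _ [_ [c ->] <-]; rewrite setTI; apply: planar_open_measurable => w /=.
rewrite in_itv /= andbT => /hg[e e0 he]; exists e => // w' h1 h2.
by rewrite /= in_itv /= andbT; exact: he.
Qed.

Lemma measurable_normc_plane :
  measurable_fun setT (fun w : R * R => normc (w.1 +i* w.2)).
Proof.
apply: planar_lsc_measurable => w c cw.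
have e0 : 0 < (normc (w.1 +i* w.2) - c) / 2 by rewrite divr_gt0 // subr_gt0.
exists ((normc (w.1 +i* w.2) - c) / 2) => // w' h1 h2.
have := normc_lerB (w.1 +i* w.2) (w'.1 +i* w'.2).
have : normc (w.1 +i* w.2 - w'.1 +i* w'.2) <= `|w.1 - w'.1| + `|w.2 - w'.2|.
  exact: normc_le_ReIm.
by rewrite distrC [`|w.2 - _|]distrC; lra.
Qed.

Lemma measurable_one_sub_normc_powR (s : R) :
  measurable_fun setT (fun w : R * R => (1 - normc (w.1 +i* w.2)) `^ s).
Proof.
apply: (measurableT_comp (measurable_powR s)).
by apply: measurable_funB => //; exact: measurable_normc_plane.
Qed.

(** Extension by 0 keeps a continuous modulus lower semicontinuous on the
    whole plane, hence measurable there. *)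
Definition disc_modulus (f : R[i]^o -> R[i]^o) (w : R * R) : R :=
  if normc (w.1 +i* w.2) < 1 then normc (f (w.1 +i* w.2)) else 0.

Lemma measurable_disc_modulus (f : R[i]^o -> R[i]^o) :
  (forall z, normc z < 1 -> ccontinuous_at f z) ->
  measurable_fun setT (disc_modulus f).
Proof.
move=> fc; apply: planar_lsc_measurable => w c.
have h0 w' : 0 <= disc_modulus f w'.
  by rewrite /disc_modulus; case: ifP => // _; exact: normc_ge0.
case: (ltP c 0) => [c0 _|c0].
  by exists 1 => // w' _ _; apply: lt_le_trans c0 _.
rewrite /disc_modulus; case: ifPn => [w1|_]; last by rewrite ltNge c0.
rewrite -subr_gt0 => cw; have [d d0 hd] := fc _ w1 _ cw.
exists (Num.min (d / 2) ((1 - normc (w.1 +i* w.2)) / 2)).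
  by rewrite lt_min !divr_gt0 // subr_gt0.
move=> w'; rewrite !lt_min => /andP[a1 a2] /andP[b1 b2].
have hw : normc (w'.1 +i* w'.2 - w.1 +i* w.2) <= `|w'.1 - w.1| + `|w'.2 - w.2|.
  exact: normc_le_ReIm.
have w'1 : normc (w'.1 +i* w'.2) < 1.
  have := normc_lerB (w'.1 +i* w'.2) (w.1 +i* w.2); lra.
rewrite w'1.
have wd : normc (w'.1 +i* w'.2 - w.1 +i* w.2) < d by lra.
have := hd _ wd; rewrite normcB_sym => hf.
have := normc_lerB (f (w.1 +i* w.2)) (f (w'.1 +i* w'.2)); lra.
Qed.

End PlanarMeasurability.

(** * The modulus near the boundary, in the mean *)
Section Boundary.
Set Implicit Arguments.
Unset Strict Implicit.
Variable R : realType.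
Variable a : nat -> R[i]^o.
Hypothesis ha : blaschke_sequence a.
Let a01 := blaschke_modulus ha.
Let D : set R := `[(- (3 / 4))%R, (3 / 4)%R]%classic.

Lemma gap_tail (e : R) : 0 < e -> exists M,
  (\sum_(M <= n <oo) (gap a n)%:E <= e%:E)%E.
Proof.
move=> e0; case: ha => _ fin.
have g0 n : xpredT n -> (0 <= (gap a n)%:E)%E.
  by move=> _; rewrite lee_fin; exact: (gap_ge0 a01 n).
have := @nneseries_tail_cvg R (fun n => (gap a n)%:E) xpredT fin g0.
move=> /fine_cvgP[[N1 _ h1] /cvgrPdist_le/(_ _ e0)[N2 _ h2]].
exists (maxn N1 N2); rewrite -(fineK (h1 _ (leq_maxl _ _))) lee_fin.
have := h2 _ (leq_maxr N1 N2); rewrite /= sub0r normrN.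
by apply: le_trans; exact: ler_norm.
Qed.

(** The first [M] zeros are far from the arc when [e] is small, so a bound that
    tends to 0 with [e] is available; the remaining zeros have a small total
    gap, and the Poisson bound is uniform in [e]. Both bounds are continuous
    in [x]. *)
Definition defect_majorant M (e : R) n x : R :=
  if (n < M)%N then 4 * e / gap a n
  else 32 * gap a n * (e / (e ^+ 2 + (x - complex.Re (a n)) ^+ 2)).

Lemma defect_majorant_ge0 M e n x : 0 < e -> 0 <= defect_majorant M e n x.
Proof.
move=> e0; have g0 := gap_ge0 a01 n; rewrite /defect_majorant; case: ifP => _.
  by apply: divr_ge0 => //; apply: mulr_ge0 => //; exact: ltW.
apply: mulr_ge0; first exact: mulr_ge0.
by apply: divr_ge0; [exact: ltW|rewrite addr_ge0 ?sqr_ge0].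
Qed.

(** A Blaschke product has modulus 1 on the circle only almost everywhere;
    what is needed is that [1 - |B|] tends to 0 in the mean along the arc
    pushed down by [e]. It is at most the sum of the defects. [H] is a
    measurable majorant of that sum. *)
Lemma boundary_modulus (eta : R) : 0 < eta -> exists2 e0 : R, 0 < e0 &
  forall e, 0 < e < e0 -> exists H : R -> \bar R,
  [/\ measurable_fun setT H, forall x, (0 <= H x)%E,
      forall x, `|x| <= 3 / 4 ->
        ((1 - normc (blaschke a (below x e)))%:E <= H x)%E &
      (\int[lebesgue_measure]_(x in D) H x <= eta%:E)%E].
Proof.
move=> eta0.
have [|M hM] := @gap_tail (eta / 2 / (32 * pi)).
  by rewrite !divr_gt0 // mulr_gt0 // pi_gt0.
pose C := \sum_(0 <= n < M) (6 / gap a n).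
have C0 : 0 <= C.
  by apply: sumr_ge0 => n _; rewrite divr_ge0 // (gap_ge0 a01).
exists (Num.min (1 / 32) (eta / 2 / (C + 1))).
  by rewrite lt_min !divr_gt0 // ltr_wpDl.
move=> e; rewrite lt_min => /andP[e0 /andP[e32 eC]].
have mD : measurable D by exact: measurable_itv.
have mDE : lebesgue_measure D = (3 / 2 : R)%:E.
  have := @lebesgue_measure_itv R `[(- (3 / 4))%R, (3 / 4)%R].
  rewrite /= lte_fin ifT; last by lra.
  by rewrite -EFinB /D => ->; congr EFin; lra.
pose h n x := (defect_majorant M e n x)%:E.
have h0 n x : (0 <= h n x)%E by rewrite lee_fin defect_majorant_ge0.
have mh n : measurable_fun setT (h n).
  apply/measurable_EFinP; rewrite /defect_majorant.
  case: (n < M)%N; first exact: measurable_cst.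
  apply: measurable_funM; first exact: measurable_cst.
  by apply: continuous_measurable_fun; exact: continuous_poisson.
exists (fun x => \sum_(0 <= n <oo) h n x)%E; split.
- exact: ge0_emeasurable_sum.
- by move=> x; apply: nneseries_ge0.
- move=> x x34; have e32' : 0 < e <= 1 / 32 by rewrite e0 ltW.
  apply: (le_trans (one_sub_blaschke_le ha (below_lt1 x34 e32'))).
  apply: lee_nneseries => n.
    by move=> _ _; rewrite lee_fin; exact: one_sub_factor_ge0 (a01 n) (below_lt1 x34 e32').
  move=> _; rewrite lee_fin /defect_majorant; case: ifP => _.
    exact: defect_upper_gap.
  exact: defect_upper_poisson.
- rewrite integral_nneseries //; last by move=> n; apply: measurable_funTS; exact: mh.
  rewrite (nneseries_split 0 M); last by move=> n _; apply: integral_ge0 => x _; exact: h0.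
  rewrite (splitr eta) EFinD add0n; apply: leeD.
    apply: (@le_trans _ _ (\sum_(0 <= n < M) (6 / gap a n * e)%:E)%E).
      rewrite !big_mkord; apply: lee_sum => n _.
      rewrite (eq_integral (cst (4 * e / gap a n)%:E)); last first.
        by move=> x _; rewrite /h /defect_majorant ltn_ord.
      rewrite integral_cst //= mDE -EFinM lee_fin.
      by lra.
    rewrite sumEFin lee_fin -mulr_suml -/C.
    have : e * (C + 1) < eta / 2 by rewrite -ltr_pdivlMr // ltr_wpDl.
    nra.
  apply: (@le_trans _ _ (\sum_(M <= n <oo) ((32 * pi)%:E * (gap a n)%:E))%E).
    rewrite [leLHS]eseries_cond [leRHS]eseries_cond; apply: lee_nneseries => n.
      by move=> _ _; apply: integral_ge0 => x _; exact: h0.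
    move=> /= Mn.
    have -> : (\int[lebesgue_measure]_(x in D) h n x =
        \int[lebesgue_measure]_(x in D) ((32 * gap a n)%:E *
        (e / (e ^+ 2 + (x - complex.Re (a n)) ^+ 2))%:E))%E.
      by apply: eq_integral => x _; rewrite /h /defect_majorant ltnNge Mn /= EFinM.
    rewrite ge0_integralZl_EFin //.
    + apply: (@le_trans _ _ ((32 * gap a n)%:E * (pi : R)%:E)%E).
        apply: lee_wpmul2l; first by rewrite lee_fin mulr_ge0 // (gap_ge0 a01).
        exact: integral_poisson_le.
      by rewrite -!EFinM lee_fin mulrAC.
    + by move=> x _; rewrite lee_fin; apply: divr_ge0; [exact: ltW|rewrite addr_ge0 ?sqr_ge0].
    + apply/measurable_EFinP; apply: measurable_funTS.
      by apply: continuous_measurable_fun; exact: continuous_poisson.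
    + by rewrite mulr_ge0 // (gap_ge0 a01).
  rewrite nneseriesZl; last by move=> n _; rewrite lee_fin (gap_ge0 a01).
  apply: (@le_trans _ _ ((32 * pi)%:E * (eta / 2 / (32 * pi))%:E)%E).
    by apply: lee_wpmul2l hM; rewrite lee_fin mulr_ge0 // pi_ge0.
  by rewrite -EFinM lee_fin mulrC divfK // mulf_neq0 // gt_eqF // pi_gt0.
Qed.

End Boundary.

(** * Counting zeros of comparable gap *)
Section Counting.
Set Implicit Arguments.
Unset Strict Implicit.
Variable R : realType.
Variable a : nat -> R[i]^o.
Hypothesis ha : blaschke_sequence a.
Hypothesis ca : forall z, normc z < 1 -> ccontinuous_at (derive1 (blaschke a)) z.
Variable s : R.
Hypothesis s01 : 0 < s < 1.
Let a01 := blaschke_modulus ha.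
Let D : set R := `[(- (3 / 4))%R, (3 / 4)%R]%classic.

Definition density (f : R[i]^o -> R[i]^o) (w : R * R) : R :=
  disc_modulus f w * (1 - normc (w.1 +i* w.2)) `^ (- s).

Lemma density_ge0 f w : 0 <= density f w.
Proof.
rewrite mulr_ge0 ?powR_ge0 // /disc_modulus.
by case: ifP => // _; exact: normc_ge0.
Qed.

Lemma measurable_density f : (forall z, normc z < 1 -> ccontinuous_at f z) ->
  measurable_fun setT (fun w => (density f w)%:E).
Proof.
move=> fc; apply/measurable_EFinP; apply: measurable_funM.
  exact: measurable_disc_modulus.
exact: measurable_one_sub_normc_powR.
Qed.

Definition vertical_mass (f : R[i]^o -> R[i]^o) (x : R) : \bar R :=
  (\int[lebesgue_measure]_y (density f (x, y))%:E)%E.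

Lemma vertical_mass_ge0 f x : (0 <= vertical_mass f x)%E.
Proof. by apply: integral_ge0 => y _; rewrite lee_fin density_ge0. Qed.

Lemma measurable_vertical_mass f : (forall z, normc z < 1 -> ccontinuous_at f z) ->
  measurable_fun setT (vertical_mass f).
Proof.
move=> fc.
have h0 w : (0 <= (density f w)%:E)%E by rewrite lee_fin density_ge0.
exact: (@measurable_fun_fubini_tonelli_F _ _ _ _ R lebesgue_measure
  (fun w : R * R => (density f w)%:E) (measurable_density fc) h0).
Qed.

Let B := blaschke a.

(** The weight [(1 - |z|)^(-s)] is at least [t^(-s)] between the depths [t] and
    [e], and the integral of [|B'|] there bounds the growth of [|B|]. *)
Lemma vertical_mass_ge x e t : `|x| <= 3 / 4 -> 0 < e < t -> t <= 1 / 32 ->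
  ((t `^ (- s) * (normc (B (below x e)) - normc (B (below x t))))%:E <=
    vertical_mass (derive1 B) x)%E.
Proof.
move=> x34 /andP[e0 et] t32; have t0 := lt_trans e0 et.
have h58 := arc_ge x34; have hE := arc_sqr x34; have h1 := arc_le1 x34.
pose y1 := arc x - t; pose y2 := arc x - e.
have y12 : y1 < y2 by rewrite /y1 /y2; lra.
have cl y : y1 <= y <= y2 ->
    normc (x +i* y) < 1 /\ 1 - normc (x +i* y) <= t.
  move=> /andP[yl yr].
  have -> : x +i* y = below x (arc x - y) by rewrite /below subKr.
  rewrite /y1 /y2 in yl yr.
  have r : 0 < arc x - y <= 1 / 32 by apply/andP; split; lra.
  split; first exact: below_lt1.
  by apply: (le_trans (one_sub_below_le x34 r)); lra.
have tpos : 0 <= t `^ (- s) by exact: powR_ge0.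
have mdy : measurable_fun setT (fun y => (density (derive1 B) (x, y))%:E).
  exact: measurable_fun_pair2 (measurable_density ca).
apply: (@le_trans _ _ (\int[lebesgue_measure]_(y in `[y1, y2])
    (density (derive1 B) (x, y))%:E)%E); last first.
  apply: ge0_subset_integral => //.
  by move=> y _; rewrite lee_fin density_ge0.
have cB y : y1 <= y <= y2 -> ccontinuous_at (derive1 B) (x +i* y).
  by move=> /cl[? _]; exact: ca.
have growth := @vertical_growth R B x y1 y2 y12
  (fun y hy => blaschke_taylor ha (cl y hy).1) cB.
apply: (@le_trans _ _ ((t `^ (- s))%:E * \int[lebesgue_measure]_(y in `[y1, y2])
    (normc (derive1 B (x +i* y)))%:E)%E).
  by rewrite EFinM; apply: lee_wpmul2l growth; rewrite lee_fin.
have mny : measurable_fun `[y1, y2] (fun y => (normc (derive1 B (x +i* y)))%:E).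
  have : measurable_fun `[y1, y2] (fun y => (disc_modulus (derive1 B) (x, y))%:E).
    apply: measurable_funTS; apply/measurable_EFinP.
    exact: measurable_fun_pair2 (measurable_disc_modulus ca).
  apply: eq_measurable_fun => y; rewrite inE /= in_itv /= => /cl[z1 _].
  by rewrite /disc_modulus /= z1.
rewrite -ge0_integralZl_EFin //; last by move=> y _; rewrite lee_fin normc_ge0.
apply: ge0_le_integral => //.
- by move=> y _; rewrite mule_ge0 // lee_fin normc_ge0.
- exact: measurable_funeM.
- exact: measurable_funTS.
move=> y; rewrite /= in_itv /= => /cl[z1 zt].
rewrite -EFinM lee_fin /density /disc_modulus /= z1 mulrC.
apply: ler_wpM2l; first exact: normc_ge0.
have z0 : 0 < 1 - normc (x +i* y) by rewrite subr_gt0.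
rewrite !powRN lef_pV2 ?posrE ?powR_gt0 //.
have [s0 _] := andP s01; by apply: ge0_ler_powR; rewrite ?nnegrE ?(ltW s0) ?(ltW z0) ?(ltW t0).
Qed.

Definition in_top n : bool := `|complex.Re (a n)| <= complex.Im (a n).

Variables (M : nat) (d : R).
Hypothesis d32 : 0 < d <= 1 / 32.

Definition top_zero n : bool := (d / 2 < gap a n <= d) && in_top n.

Definition close_top_zero (x : R) n : bool :=
  top_zero n && (`|x - complex.Re (a n)| <= d).

Let N := (\sum_(n < M | top_zero n) 1)%N.
Let m x := (\sum_(n < M | close_top_zero x n) 1)%N.

Lemma close_le x : (m x <= N)%N.
Proof.
rewrite /m /N big_mkcond [leqRHS]big_mkcond /=; apply: leq_sum => n _.
by rewrite /close_top_zero; case: (top_zero n) => //=; case: ifP.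
Qed.

(** At depth [d / m x] each of the [m x] zeros near [x] has a defect of at least
    [1 / (288 * m x)], so [|B|^2 <= 1 / (1 + 1 / 288)]. *)
Lemma blaschke_dip x : `|x| <= 3 / 4 -> (0 < m x)%N ->
  normc (B (below x (d / (m x)%:R))) <= 1 - 1 / 600.
Proof.
move=> x34 m0; set k := m x in m0 *; set t := d / k%:R.
have k0 : 0 < k%:R :> R by rewrite ltr0n.
have k1 : 1 <= k%:R :> R by rewrite ler1n.
have /andP[d0 d1] := d32.
have td : 0 < t <= d.
  by rewrite /t divr_gt0 //= ler_pdivrMr // ler_peMr // ltW.
have t32 : 0 < t <= 1 / 32 by case/andP: td => -> td; exact: le_trans d1.
have z1 := below_lt1 x34 t32.
have := partial_product_le_inv ha M (close_top_zero x) z1.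
have S : 1 / 288 <= \sum_(n < M | close_top_zero x n) defect (a n) (below x t).
  apply: (@le_trans _ _ (\sum_(n < M | close_top_zero x n) t / (288 * d))).
    rewrite sumr_const; rewrite /t.
    have -> : #|(fun n : 'I_M => close_top_zero x n)| = k by rewrite /k /m sum1_card.
    rewrite -[_ *+ k]mulr_natr.
    have -> : d / k%:R / (288 * d) * k%:R = 1 / 288.
      by field; rewrite !gt_eqF.
    by [].
  apply: ler_sum => n /andP[/andP[gd sec] xu].
  by apply: defect_lower => //.
have := blaschke_le_partial ha M z1; have := normc_ge0 (B (below x t)).
rewrite -/B; move: (normc (B _)) (normc (partial_product _ _ _)) (\sum_(_ < _ | _) _) S.
move=> b q S hS b0 bq hq.
have : q ^+ 2 * (289 / 288) <= 1.
  by apply: le_trans hq; rewrite ler_wpM2l ?sqr_ge0 //; lra.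
have : b ^+ 2 <= q ^+ 2 by rewrite ler_sqr // nnegrE // (le_trans b0).
move=> h1 h2; rewrite leNgt; apply/negP => h3.
have : 0 < (b - (1 - 1 / 600)) * b by apply: mulr_gt0; lra.
move: h1 h2; rewrite !expr2; nra.
Qed.

(** Between the depths [d / m] and [e] the modulus rises from at most
    [1 - 1 / 600] to at least [1 - H], which costs the mass
    [(m / d)^s (1 / 600 - H)]. Multiplied by [N^(1 - s) d^s] the factor
    [(m / d)^s] becomes [N^(1 - s) m^s], which lies between [m] and [N]. *)
Lemma counting_pointwise x e (H : \bar R) : `|x| <= 3 / 4 -> 0 < e ->
  e * N%:R < d ->
  ((1 - normc (B (below x e)))%:E <= H)%E -> (0 <= H)%E ->
  (((m x)%:R / 600)%:E <=
   (N%:R `^ (1 - s) * d `^ s)%:E * vertical_mass (derive1 B) x + N%:R%:E * H)%E.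
Proof.
move=> x34 e0 eN BH H0.
have /andP[d0 d1] := d32; have /andP[s0 s1] := s01.
have A0 : 0 <= N%:R `^ (1 - s) * d `^ s by rewrite mulr_ge0 ?powR_ge0.
case: (posnP (m x)) => [->|m0].
  rewrite mul0r; apply: adde_ge0; apply: mule_ge0 => //; exact: vertical_mass_ge0.
have mN := close_le x; have dip := blaschke_dip x34 m0.
set k : R := (m x)%:R in dip *; set n : R := N%:R in eN A0 *.
have k0 : 0 < k by rewrite ltr0n.
have k1 : 1 <= k by rewrite ler1n.
have kn : k <= n by rewrite ler_nat.
have n0 : 0 < n by exact: lt_le_trans kn.
set t := d / k in dip.
have t0 : 0 < t by rewrite divr_gt0.
have td : t <= d by rewrite /t ler_pdivrMr // ler_peMr // ltW.
have et : e < t.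
  rewrite /t ltr_pdivlMr //; apply: le_lt_trans eN.
  by rewrite ler_wpM2l // ltW.
have e32 : 0 < e <= 1 / 32.
  by rewrite e0 /=; apply: (le_trans (ltW et)); apply: le_trans d1.
have Be1 : normc (B (below x e)) <= 1 by apply: blaschke_le1 => //; exact: below_lt1.
have J := @vertical_mass_ge x e t x34 _ (le_trans td d1).
rewrite e0 et in J; move: J => /(_ isT) J.
have AJ := @lee_wpmul2l R (n `^ (1 - s) * d `^ s)%:E _ _ _ J.
rewrite lee_fin in AJ; move: AJ => /(_ A0) AJ.
have NH := @lee_wpmul2l R n%:E _ _ _ BH.
rewrite lee_fin in NH; move: NH => /(_ (ltW n0)) NH.
apply: le_trans (leeD AJ NH); rewrite -!EFinM -EFinD lee_fin.
move: (normc (B (below x e))) (normc (B (below x t))) Be1 dip => be bt be1 btd.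
have Q : n `^ (1 - s) * d `^ s * t `^ (- s) = n `^ (1 - s) * k `^ s.
  rewrite -mulrA /t powRM ?invr_ge0 ?(ltW d0) ?(ltW k0) //.
  rewrite -[k^-1]powR_inv1 ?(ltW k0) // -powRrM mulN1r opprK powRN.
  by rewrite mulVKf // gt_eqF // powR_gt0.
rewrite mulrA Q.
have kk : k `^ (1 - s) * k `^ s = k.
  rewrite -powRD ?subrK ?powRr1 ?(ltW k0) //.
  by rewrite gt_eqF // implybT.
have nn : n `^ (1 - s) * n `^ s = n.
  rewrite -powRD ?subrK ?powRr1 ?(ltW n0) //.
  by rewrite gt_eqF // implybT.
have Ql : k <= n `^ (1 - s) * k `^ s.
  rewrite -{1}kk ler_wpM2r ?powR_ge0 //.
  by apply: ge0_ler_powR; rewrite ?nnegrE ?(ltW k0) ?(ltW n0) // subr_ge0 ltW.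
have Qr : n `^ (1 - s) * k `^ s <= n.
  rewrite -{2}nn ler_wpM2l ?powR_ge0 //.
  by apply: ge0_ler_powR; rewrite ?nnegrE ?(ltW k0) ?(ltW n0) // ltW.
move: (_ * _) Ql Qr => q Ql Qr.
have q0 : 0 <= q by apply: le_trans Ql; exact: ltW.
have : q * (1 / 600 - (1 - be)) <= q * (be - bt) by rewrite ler_wpM2l //; lra.
have : 0 <= (n - q) * (1 - be) by rewrite mulr_ge0 // subr_ge0.
lra.
Qed.

Lemma top_zero_Re n : top_zero n -> `|complex.Re (a n)| <= 5 / 7.
Proof.
move=> /andP[_ sec]; apply: top_sector_Re_le sec _.
rewrite -normc_sqr; apply: ltW; apply: sqr_lt1; rewrite normc_ge0 /=.
by case/andP: (a01 n).
Qed.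

Let near_zero n : set R :=
  `[complex.Re (a n) - d, complex.Re (a n) + d]%classic.

Lemma close_indic x : ((m x)%:R / 600)%:E =
  ((600^-1)%:E * \sum_(n < M | top_zero n) (\1_(near_zero n) x)%:E)%E :> \bar R.
Proof.
rewrite sumEFin -EFinM mulrC; congr (_ * _)%:E.
rewrite /m natr_sum /close_top_zero big_mkcondr /=; apply: eq_bigr => n _.
rewrite indicE; case: ifPn => h.
  rewrite mem_set //; move: h; rewrite ler_norml /near_zero /= in_itv /= => /andP[? ?].
  by apply/andP; split; lra.
rewrite memNset // /near_zero /= in_itv /= => /andP[? ?]; move: h; rewrite ler_norml.
by move/negP; apply; apply/andP; split; lra.
Qed.

Lemma measurable_close : measurable_fun setT (fun x => ((m x)%:R / 600 : R)%:E).
Proof.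
rewrite (_ : (fun x => _) = (fun x => ((600^-1)%:E *
    \sum_(n < M | top_zero n) (\1_(near_zero n) x)%:E)%E)); last first.
  by apply/funext => x; exact: close_indic.
apply: measurable_funeM; under eq_fun do rewrite -big_filter.
by apply: emeasurable_sum => n; apply/measurable_EFinP; apply: measurable_indic; exact: measurable_itv.
Qed.

Lemma integral_close : (\int[lebesgue_measure]_(x in D) (((m x)%:R : R) / 600)%:E
   = (N%:R * (2 * d) / 600)%:E)%E.
Proof.
have /andP[d0 d1] := d32.
have mD : measurable D by exact: measurable_itv.
have mI n : measurable (near_zero n) by exact: measurable_itv.
have mi n : measurable_fun D (fun x => (\1_(near_zero n) x : R)%:E).
  by apply/measurable_EFinP; apply: measurable_funTS; exact: measurable_indic.
have c0 : 0 <= 600^-1 :> R by rewrite invr_ge0 ler0n.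
pose F x : \bar R := (\sum_(n < M | top_zero n) (\1_(near_zero n) x)%:E)%E.
have F0 x : D x -> (0 <= F x)%E by move=> _; apply: sume_ge0 => n _; rewrite lee_fin.
have mF : measurable_fun D F.
  rewrite /F; under eq_fun do rewrite -big_filter.
  by apply: emeasurable_sum => n; exact: mi.
transitivity (\int[lebesgue_measure]_(x in D) ((600^-1)%:E * F x))%E.
  by apply: eq_integral => x _; rewrite close_indic.
rewrite (@ge0_integralZl_EFin _ _ R lebesgue_measure D mD F F0 mF _ c0) /F.
under eq_integral do rewrite -big_filter.
rewrite ge0_integral_sum //; last by move=> n; exact: mi.
rewrite big_filter (eq_bigr (fun=> (2 * d)%:E)); last first.
  move=> n tn; rewrite integral_indic //; last exact: mI.
  rewrite setIidl.
    have := @lebesgue_measure_itv R `[complex.Re (a n) - d, complex.Re (a n) + d].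
    rewrite /= lte_fin ifT; last by lra.
    by rewrite /near_zero => ->; rewrite -EFinB; congr EFin; lra.
  have := top_zero_Re tn; rewrite ler_norml => /andP[u1 u2].
  move=> x; rewrite /near_zero /D /= !in_itv /= => /andP[? ?]; apply/andP; split; lra.
rewrite sumEFin -EFinM sumr_const; congr EFin.
by rewrite /N sum1_card -[_ *+ #|_|]mulr_natl [LHS]mulrC.
Qed.

(** Integrate [counting_pointwise] over [|x| <= 3 / 4]: each of the [N] zeros
    contributes an interval of length [2 d] to the left side, and the error
    term vanishes by [boundary_modulus]. *)
Lemma counting_bound K : 0 <= K ->
  (\int[lebesgue_measure]_x vertical_mass (derive1 B) x <= K%:E)%E ->
  N%:R * d <= 300 * K * (N%:R `^ (1 - s) * d `^ s).
Proof.
move=> K0 JK; have /andP[d0 d1] := d32.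
set A := _ `^ _ * _ `^ _; have A0 : 0 <= A by rewrite mulr_ge0 ?powR_ge0.
(* an arbitrary [eta'] absorbs the error term of [counting_pointwise] *)
suff : N%:R * (2 * d) / 600 <= A * K by lra.
apply/ler_addgt0Pr => eta' eta'0.
pose eta := eta' / (N%:R + 1).
have N0 : 0 <= N%:R :> R by [].
have N1 : 0 < N%:R + 1 :> R by rewrite ltr_wpDl.
have eta0 : 0 < eta by rewrite divr_gt0.
have [e0 e00 he] := boundary_modulus ha eta0.
(* small enough for [boundary_modulus] and for [e < d / m x] at every [x] *)
pose e := Num.min e0 (d / (N%:R + 1)) / 2.
have min0 : 0 < Num.min e0 (d / (N%:R + 1)) by rewrite lt_min e00 divr_gt0.
have ep : 0 < e by rewrite divr_gt0.
have em : e < Num.min e0 (d / (N%:R + 1)) by rewrite /e; lra.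
move: em; rewrite lt_min => /andP[ee0 ed].
have [|H [mH H0 BH IH]] := he e; first by rewrite ep.
have eN : e * N%:R < d.
  move: ed; rewrite ltr_pdivlMr // => ed.
  by apply: le_lt_trans ed; rewrite ler_wpM2l ?ltW // ltrDl.
have mD : measurable D by exact: measurable_itv.
have mJ := measurable_vertical_mass ca.
have mJD : measurable_fun D (vertical_mass (derive1 B)) by exact: measurable_funTS.
have mHD : measurable_fun D H by exact: measurable_funTS.
have J0 := @vertical_mass_ge0 (derive1 B).
have AJ0 x : D x -> (0 <= A%:E * vertical_mass (derive1 B) x)%E.
  by move=> _; apply: mule_ge0.
have NH0 x : D x -> (0 <= N%:R%:E * H x)%E.
  by move=> _; apply: mule_ge0; rewrite ?lee_fin.
rewrite -lee_fin -integral_close.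
apply: (@le_trans _ _ (\int[lebesgue_measure]_(x in D)
   (A%:E * vertical_mass (derive1 B) x + N%:R%:E * H x))%E).
  apply: ge0_le_integral.
  - exact: mD.
  - by move=> x _; rewrite lee_fin; apply: divr_ge0; exact: ler0n.
  - by apply: measurable_funTS; exact: measurable_close.
  - by apply: emeasurable_funD; exact: measurable_funeM.
  - move=> x; rewrite /D /= in_itv /= => xD.
    have x34 : `|x| <= 3 / 4 by rewrite ler_norml.
    by apply: (counting_pointwise x34 ep eN (BH x x34)).
rewrite ge0_integralD //; try exact: measurable_funeM.
rewrite ge0_integralZl_EFin // ge0_integralZl_EFin //.
rewrite EFinD; apply: leeD.
  rewrite [leRHS]EFinM; apply: lee_wpmul2l; first by rewrite lee_fin.
  by apply: le_trans JK; apply: ge0_subset_integral.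
apply: (@le_trans _ _ (N%:R%:E * eta%:E)%E); first by apply: lee_wpmul2l; rewrite ?lee_fin.
rewrite -EFinM lee_fin /eta mulrA ler_pdivrMr // mulrC; apply: ler_wpM2l; first exact: ltW.
by rewrite lerDl.
Qed.

End Counting.

(** * Summation over the dyadic levels of a sector *)
Section TopSector.
Set Implicit Arguments.
Unset Strict Implicit.
Variable R : realType.
Variable a : nat -> R[i]^o.
Hypothesis ha : blaschke_sequence a.
Hypothesis ca : forall z, normc z < 1 -> ccontinuous_at (derive1 (blaschke a)) z.
Variable s : R.
Hypothesis s01 : 0 < s < 1.
Variable K : R.
Hypothesis K0 : 0 <= K.
Hypothesis mass :
  (\int[lebesgue_measure]_x vertical_mass s (derive1 (blaschke a)) x <= K%:E)%E.
Let a01 := blaschke_modulus ha.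
Let q := (1 - s) / s.

(** The inequality of [counting_bound], solved for [N]: there are at most a
    constant times [d^(-q)] zeros of gap about [d]. *)
Lemma powR_solve (N d C : R) : 0 <= N -> 0 < d -> 0 <= C ->
  N * d <= C * (N `^ (1 - s) * d `^ s) -> N * d `^ q <= C `^ s^-1.
Proof.
have /andP[s0 s1] := s01.
rewrite le_eqVlt => /predU1P[<- _ _ _|N0 d0 C0 h]; first by rewrite mul0r powR_ge0.
have NE : N = N `^ (1 - s) * N `^ s.
  by rewrite -powRD ?subrK ?powRr1 ?(ltW N0) // gt_eqF // implybT.
have dE : d = d `^ s * d `^ (1 - s).
  by rewrite -powRD ?subrKC ?powRr1 ?(ltW d0) // gt_eqF // implybT.
have P0 : 0 < N `^ (1 - s) * d `^ s by rewrite mulr_gt0 // powR_gt0.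
have h2 : N `^ s * d `^ (1 - s) <= C.
  rewrite -(ler_pM2l P0) [leRHS]mulrC.
  rewrite (_ : _ * (_ * _) = N * d) //.
  by rewrite [in RHS]NE [in RHS]dE; ring.
have -> : N * d `^ q = (N `^ s * d `^ (1 - s)) `^ s^-1.
  rewrite powRM ?powR_ge0 // -!powRrM divff ?gt_eqF // powRr1 //.
  exact: ltW.
by apply: ge0_ler_powR; rewrite ?nnegrE ?mulr_ge0 ?powR_ge0 // invr_ge0 ltW.
Qed.

Lemma dyadic_level (g : R) : 0 < g < 1 ->
  exists k : nat, 2^-1 ^+ k / 2 < g <= 2^-1 ^+ k.
Proof.
move=> /andP[g0 g1].
have ex : exists k, 2^-1 ^+ k < g.
  exists (Num.trunc g^-1).+1; rewrite exprVn invf_plt ?posrE ?exprn_gt0 //.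
  apply: lt_trans (truncnS_gt _) _.
  by rewrite -natrX ltr_nat ltn_expl.
(* the level is one less than the first power of [1 / 2] below [g] *)
case: (ex_minnP ex) => [[|k]] hk min; first by move: hk; rewrite expr0 ltNge ltW.
exists k; rewrite -exprSr hk /= leNgt; apply/negP => /min.
by rewrite ltnn.
Qed.

Lemma dyadic_count (M k : nat) (beta : R) : (5 <= k)%N -> q < beta ->
  \sum_(n < M | top_zero a (2^-1 ^+ k) n) (2^-1 ^+ k) `^ beta <=
  (300 * K) `^ s^-1 * (2^-1 `^ (beta - q)) ^+ k.
Proof.
move=> k5 qb; set d := 2^-1 ^+ k.
have d0 : 0 < d by rewrite exprn_gt0.
have d32 : 0 < d <= 1 / 32.
  rewrite d0 /= (@le_trans _ _ (2^-1 ^+ 5)) //.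
    by apply: ler_wiXn2l => //; lra.
  rewrite exprVn mul1r; have -> : (2 ^+ 5 = 32 :> R) by rewrite -natrX.
  by [].
have := counting_bound ha ca s01 M d32 K0 mass.
move/(powR_solve _ d0) => -/(_ _ _) h.
have -> : \sum_(n < M | top_zero a d n) d `^ beta =
    (\sum_(n < M | top_zero a d n) 1)%N%:R * d `^ q * d `^ (beta - q).
  rewrite -mulrA -powRD ?subrKC; last by rewrite (gt_eqF d0) implybT.
  by rewrite sumr_const sum1_card mulr_natl.
have -> : (2^-1 `^ (beta - q)) ^+ k = d `^ (beta - q).
  rewrite /d -[in RHS]powR_mulrn ?invr_ge0 // -powRrM mulrC powRrM.
  by rewrite powR_mulrn // powR_ge0.
apply: ler_wpM2r; first exact: powR_ge0.
by apply: h; [exact: ler0n|apply: mulr_ge0 => //; exact: ler0n].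
Qed.

(** Level [2^-k] contributes at most a constant times [2^(-k (beta - q))], a
    convergent geometric series. The levels [k < 5] lie outside the range of
    [counting_bound], but there [gap^beta <= 1 <= 32 * gap]. *)
Lemma top_sector_summable (beta : R) : q < beta ->
  exists C, forall M, \sum_(n < M | in_top a n) gap a n `^ beta <= C.
Proof.
move=> qb; have [S S0 gS] := sum_gap_bounded ha.
have /andP[s0 s1] := s01.
have q0 : 0 <= q by rewrite /q divr_ge0 // ltW // subr_gt0.
have b0 : 0 < beta by exact: le_lt_trans qb.
have [lev hlev] := choice (fun n =>
  dyadic_level (introT andP (conj (gap_gt0 a01 n) (gap_lt1 a01 n)))).
pose r := 2^-1 `^ (beta - q).
have r0 : 0 <= r by exact: powR_ge0.
have r1 : r < 1.
  have bq : 0 < beta - q by rewrite subr_gt0.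
  have := @gt0_ltr_powR R _ bq 2^-1 1; rewrite powR1; apply; rewrite ?nnegrE //; lra.
pose C1 := (300 * K) `^ s^-1.
have C10 : 0 <= C1 by exact: powR_ge0.
exists (32 * S + C1 / (1 - r)) => M.
pose L := (\max_(n < M) lev n).+1.
have bound n : (n < M)%N -> in_top a n -> gap a n `^ beta <=
    32 * gap a n + \sum_(k < L | (5 <= k)%N && top_zero a (2^-1 ^+ k) n)
       (2^-1 ^+ k) `^ beta.
  move=> nM sn; have /andP[l1 l2] := hlev n.
  have g0 := gap_gt0 a01 n; have g1 := gap_lt1 a01 n.
  case: (leqP 5 (lev n)) => l5; last first.
    apply: (@le_trans _ _ (32 * gap a n)); last first.
      by rewrite lerDl sumr_ge0 // => k _; exact: powR_ge0.
    apply: (@le_trans _ _ 1).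
      rewrite -(powRr0 (gap a n)); apply: ger_powR; rewrite ?g0 ?ltW //.
    have : 2^-1 ^+ 4 <= 2^-1 ^+ (lev n) :> R.
      by apply: ler_wiXn2l => //; lra.
    have -> : 2^-1 ^+ 4 = 1 / 16 :> R.
      by rewrite exprVn mul1r -natrX.
    by lra.
  have lL : (lev n < L)%N by rewrite ltnS (leq_bigmax (Ordinal nM)).
  rewrite (bigD1 (Ordinal lL)) /=; last by rewrite l5 /top_zero hlev.
  apply: (@le_trans _ _ ((2^-1 ^+ lev n) `^ beta)).
    by apply: ge0_ler_powR; rewrite ?nnegrE ?(ltW b0) ?(ltW g0) ?exprn_ge0 ?invr_ge0.
  rewrite addrCA lerDl; apply: addr_ge0; first by rewrite mulr_ge0 ?(ltW g0).
  by apply: sumr_ge0 => k _; exact: powR_ge0.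
apply: (@le_trans _ _ (\sum_(n < M | in_top a n) (32 * gap a n +
   \sum_(k < L | (5 <= k)%N && top_zero a (2^-1 ^+ k) n) (2^-1 ^+ k) `^ beta))).
  by apply: ler_sum => n sn; exact: bound.
rewrite big_split /=; apply: lerD.
  rewrite -mulr_sumr ler_wpM2l //; apply: le_trans (gS M).
  rewrite big_mkcond; apply: ler_sum => n _; case: ifP => // _.
  exact: (gap_ge0 a01).
rewrite (exchange_big_dep (fun k : 'I_L => (5 <= k)%N)) /=; last first.
  by move=> n k _ /andP[].
apply: (@le_trans _ _ (\sum_(k < L) C1 * r ^+ k)).
  rewrite big_mkcond; apply: ler_sum => k _; case: ifPn => k5; last first.
    by rewrite mulr_ge0 // exprn_ge0.
  apply: le_trans (dyadic_count M k5 qb).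
  rewrite [leLHS]big_mkcond [leRHS]big_mkcond /=; apply: ler_sum => n _.
  case: ifP => [/and3P[_ _ ->//]|_]; case: ifP => // _; exact: powR_ge0.
rewrite -mulr_sumr; apply: ler_wpM2l => //.
rewrite -[leRHS]mul1r ler_pdivlMr ?subr_gt0 //.
have := subrX1 r L; have : 0 <= r ^+ L by exact: exprn_ge0.
move: (\sum_(_ < L) _) => G; lra.
Qed.

End TopSector.

(** * Quarter turns *)
Section Rotation.
Set Implicit Arguments.
Unset Strict Implicit.
Variable R : realType.

(** The zeros of [z |-> blaschke a ('i * z)]; see [blaschke_rotate]. *)
Definition rotate (a : nat -> R[i]^o) (n : nat) : R[i]^o := conjc 'i * a n.

Lemma normc_rotate a n : normc (rotate a n) = normc (a n).
Proof. by rewrite /rotate (normcM (conjc 'i)) normc_conj normc_i mul1r. Qed.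

Lemma blaschke_rotate a (z : R[i]^o) : blaschke a ('i * z) = blaschke (rotate a) z.
Proof.
rewrite /blaschke; congr (limn _); apply/funext => N.
by apply: eq_bigr => n _; rewrite factor_rotate // normc_i.
Qed.

Lemma blaschke_sequence_rotate a :
  blaschke_sequence a -> blaschke_sequence (rotate a).
Proof.
move=> [a01 fin]; split => [n|]; first by rewrite normc_rotate.
by under eq_eseriesr do rewrite normc_rotate.
Qed.

Lemma derive1_rotate a (z : R[i]^o) : blaschke_sequence a -> normc z < 1 ->
  derive1 (blaschke (rotate a)) z = derive1 (blaschke a) ('i * z) * 'i.
Proof.
move=> ha z1; have iz1 : normc ('i * z) < 1 by rewrite (normcM 'i) normc_i mul1r.
have [K [d [K0 d0 hK]]] := blaschke_taylor ha iz1.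
apply: derive1_ccvg => e e0.
have K1 : 0 < K + 1 by rewrite ltr_wpDl.
exists (Num.min d (e / (K + 1))); first by rewrite lt_min d0 divr_gt0.
move=> w; rewrite lt_min => /andP[wd we].
have nw : normc ('i * w - 'i * z) = normc (w - z).
  by rewrite -mulrBr (normcM 'i) normc_i mul1r.
have := hK ('i * w); rewrite nw => /(_ wd).
rewrite !blaschke_rotate -mulrBr mulrA => h; apply: (le_trans h).
rewrite expr2 mulrA ler_wpM2r ?normc_ge0 //.
move: we; rewrite ltr_pdivlMr // mulrDr mulr1 => we.
by have := normc_ge0 (w - z); lra.
Qed.

Lemma ccontinuous_rotate a : blaschke_sequence a ->
  (forall z, normc z < 1 -> ccontinuous_at (derive1 (blaschke a)) z) ->
  forall z, normc z < 1 -> ccontinuous_at (derive1 (blaschke (rotate a))) z.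
Proof.
move=> ha ca z z1; have iz1 : normc ('i * z) < 1 by rewrite (normcM 'i) normc_i mul1r.
move=> e /(ca _ iz1)[d d0 hd].
exists (Num.min d (1 - normc z)); first by rewrite lt_min d0 subr_gt0.
move=> w; rewrite lt_min => /andP[wd wz].
have w1 : normc w < 1 by have := normcD_le (w - z) z; rewrite subrK; lra.
rewrite (derive1_rotate ha w1) (derive1_rotate ha z1).
have := hd ('i * w); rewrite -mulrBr (normcM 'i) normc_i mul1r => /(_ wd).
move: (derive1 _ _) (derive1 _ _) => p q; rewrite -mulrBl (normcM (_ - _)) normc_i.
by rewrite mulr1.
Qed.

Lemma ge0_integral_reflect (g : R -> \bar R) :
  measurable_fun setT g -> (forall y, (0 <= g y)%E) ->
  (\int[lebesgue_measure]_y g (- y)%R = \int[lebesgue_measure]_y g y)%E.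
Proof.
move=> mg g0.
pose opp : measurableTypeR R -> measurableTypeR R := -%R.
have mopp : measurable_fun setT opp by exact: oppr_measurable.
have := @ge0_integral_pushforward _ _ _ _ R opp mopp lebesgue_measure setT g
  measurableT mg (fun y _ => g0 y).
rewrite preimage_setT => <-.
by apply: eq_measure_integral => A mA _; exact: lebesgue_measureN.
Qed.

Lemma density_eq (s : R) (f g : R[i]^o -> R[i]^o) (v w : R * R) :
  normc (v.1 +i* v.2) = normc (w.1 +i* w.2) ->
  (normc (v.1 +i* v.2) < 1 ->
    normc (g (v.1 +i* v.2)) = normc (f (w.1 +i* w.2))) ->
  density s g v = density s f w.
Proof.
rewrite /density /disc_modulus => -> h; congr (_ * _).
by case: ifP => // /h.
Qed.

(** The quarter turn of the plane is a reflection of one axis followed by an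
    exchange of the axes, so it preserves area by the invariance of Lebesgue
    measure under negation and by the Tonelli theorem. *)
Lemma mass_rotate (s : R) a : blaschke_sequence a ->
  (forall z, normc z < 1 -> ccontinuous_at (derive1 (blaschke a)) z) ->
  (\int[lebesgue_measure]_x vertical_mass s (derive1 (blaschke (rotate a))) x =
   \int[lebesgue_measure]_x vertical_mass s (derive1 (blaschke a)) x)%E.
Proof.
move=> ha ca; set f := derive1 (blaschke a).
pose F w := (density s f w)%:E.
have mF : measurable_fun setT F by exact: measurable_density.
have F0 w : (0 <= F w)%E by rewrite lee_fin density_ge0.
transitivity (\int[lebesgue_measure]_y \int[lebesgue_measure]_x F (x, y))%E;
  last exact/esym/(@fubini_tonelli _ _ _ _ R lebesgue_measure lebesgue_measure F mF F0).
apply: eq_integral => x _.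
transitivity (\int[lebesgue_measure]_y F (- y, x)%R)%E; last first.
  apply: (@ge0_integral_reflect (fun y => F (y, x))); last by move=> y; exact: F0.
  exact: measurable_fun_pair1 mF.
apply: eq_integral => y _; rewrite /F; congr EFin.
have iz : 'i * (x +i* y) = (- y) +i* x :> R[i].
  by apply/eqP; rewrite eq_complex /=; apply/andP; split; apply/eqP; ring.
have nz : normc (x +i* y) = normc ((- y) +i* x).
  by rewrite -iz (normcM 'i) normc_i mul1r.
apply: density_eq; [exact: nz|move=> z1].
by rewrite (derive1_rotate ha z1) -/f iz (normcM (f _)) normc_i mulr1.
Qed.

End Rotation.

(** * From the Bergman norm to a weighted area integral *)
Section Bergman.
Set Implicit Arguments.
Unset Strict Implicit.
Variable R : realType.

(** Since [|B'| (1 - |z|) <= 1] and [p <= 1],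
    [|B'|^(1 - p) <= (1 - |z|)^(p - 1)]; multiplying by
    [|B'|^p (1 - |z|)^(alpha + 1 - p)] gives
    [|B'| (1 - |z|)^(- (p - alpha - 1)) <= |B'|^p (1 - |z|)^alpha]. *)
Lemma bergman_mass (p alpha : R) (a : nat -> R[i]^o) :
  0 < p <= 1 -> blaschke_sequence a ->
  bergman_space p alpha (derive1 (blaschke a)) ->
  (\int[lebesgue_measure]_x
     vertical_mass (p - alpha - 1) (derive1 (blaschke a)) x < +oo)%E.
Proof.
move=> /andP[p0 p1] ha [an fin]; set f := derive1 (blaschke a) in an fin *.
have cf z : normc z < 1 -> ccontinuous_at f z.
  by move=> z1; apply: derivable_ccontinuous; exact: an.
set s := p - alpha - 1.
have mF : measurable_fun setT (fun w => (density s f w)%:E) by exact: measurable_density.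
have F0 w : (0 <= (density s f w)%:E)%E by rewrite lee_fin density_ge0.
rewrite -[ltLHS](@fubini_tonelli1 _ _ _ _ R lebesgue_measure lebesgue_measure _ mF F0).
move: fin; rewrite /bergman_norm; set X := integral _ _ _ => fin.
have X0 : (0 <= X)%E.
  by apply: integral_ge0 => w _; rewrite lee_fin mulr_ge0 ?powR_ge0.
have Xfin : (X < +oo)%E.
  have pV : p^-1 != 0 by rewrite invr_eq0 gt_eqF.
  rewrite ltey; apply/eqP => Xoo; move: fin; rewrite Xoo gt0_muley; last first.
    by rewrite lte_fin invr_gt0 pi_gt0.
  by rewrite poweRyr.
apply: le_lt_trans Xfin.
pose G (w : R * R) : \bar R :=
  (disc_modulus f w `^ p * (1 - normc (w.1 +i* w.2)) `^ alpha)%:E.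
have GE w : (fun w => (normc (f (w.1 +i* w.2)) `^ p
    * (1 - normc (w.1 +i* w.2)) `^ alpha)%:E) \_
    [set w : R * R | unit_disc (w.1 +i* w.2)] w = G w.
  rewrite patchE /G /disc_modulus; case: ifPn => w1.
    by rewrite inE in w1; rewrite w1.
  rewrite notin_setE in w1; rewrite ifF; last by apply/negbTE/negP.
  by rewrite powR0 ?mul0r // gt_eqF.
have -> : X = (\int[lebesgue_measure \x lebesgue_measure]_w G w)%E.
  by rewrite /X integral_mkcond; apply: eq_integral => w _; exact: GE.
apply: ge0_le_integral.
- exact: measurableT.
- by move=> w _; exact: F0.
- exact: mF.
- by apply/measurable_EFinP; apply: measurable_funM;
    [apply: (measurableT_comp (measurable_powR p)); exact: measurable_disc_modulus
    |exact: measurable_one_sub_normc_powR].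
- move=> w _; rewrite lee_fin /density /disc_modulus.
case: ifPn => w1; last by rewrite mul0r mulr_ge0 ?powR_ge0.
have z0 : 0 < 1 - normc (w.1 +i* w.2) by rewrite subr_gt0.
have := blaschke_derive_le ha w1; rewrite -/f.
have := normc_ge0 (f (w.1 +i* w.2)).
move: (normc (f _)) (1 - normc _) z0 => u v v0 u0 uv.
have vE : v `^ alpha = v `^ (p - 1) * v `^ (- s).
  rewrite -powRD; last by rewrite (gt_eqF v0) implybT.
  by congr (_ `^ _); rewrite /s; ring.
rewrite vE mulrA ler_wpM2r ?powR_ge0 //.
have [->|un0] := eqVneq u 0; first by rewrite mulr_ge0 ?powR_ge0.
have up : 0 < u by rewrite lt_def un0.
have uE : u = u `^ p * u `^ (1 - p).
  by rewrite -powRD ?subrKC ?powRr1 // (gt_eqF up) implybT.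
rewrite [leLHS]uE; apply: ler_wpM2l; first exact: powR_ge0.
have -> : v `^ (p - 1) = v^-1 `^ (1 - p).
  by rewrite -[v^-1]powR_inv1 ?(ltW v0) // -powRrM mulN1r opprB.
apply: ge0_ler_powR; rewrite ?nnegrE ?invr_ge0 ?(ltW v0) ?subr_ge0 //.
by rewrite -[v^-1]mul1r ler_pdivlMr.
Qed.

End Bergman.

(** * Summation over all zeros *)
Section AllZeros.
Set Implicit Arguments.
Unset Strict Implicit.
Variable R : realType.
Variables (s beta K : R).
Hypothesis s01 : 0 < s < 1.
Hypothesis K0 : 0 <= K.
Hypothesis hbeta : (1 - s) / s < beta.

(** What is known about [a] once its Bergman norm has been used, in a form that
    a quarter turn preserves. *)
Definition admissible (a : nat -> R[i]^o) : Prop :=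
  [/\ blaschke_sequence a,
      forall z, normc z < 1 -> ccontinuous_at (derive1 (blaschke a)) z &
      (\int[lebesgue_measure]_x vertical_mass s (derive1 (blaschke a)) x <= K%:E)%E].

Lemma admissible_rotate a : admissible a -> admissible (rotate a).
Proof.
move=> [ha ca ma]; split; first exact: blaschke_sequence_rotate.
  exact: ccontinuous_rotate.
by rewrite mass_rotate.
Qed.

Lemma gap_rotate (a : nat -> R[i]^o) n : gap (rotate a) n = gap a n.
Proof. by rewrite /gap normc_rotate. Qed.

Lemma admissible_top a : admissible a ->
  exists C, forall M, \sum_(n < M | in_top a n) gap a n `^ beta <= C.
Proof. by move=> [ha ca ma]; exact: (top_sector_summable ha ca s01 K0 ma). Qed.

Lemma rotate_ReIm (a : nat -> R[i]^o) n :
  complex.Re (rotate a n) = complex.Im (a n) /\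
  complex.Im (rotate a n) = - complex.Re (a n).
Proof. by rewrite /rotate; case: (a n) => u v /=; split; ring. Qed.

Lemma four_sectors (a : nat -> R[i]^o) n :
  [|| in_top a n, in_top (rotate a) n, in_top (rotate (rotate a)) n
    | in_top (rotate (rotate (rotate a))) n].
Proof.
rewrite /in_top.
have [-> ->] := rotate_ReIm (rotate (rotate a)) n.
have [-> ->] := rotate_ReIm (rotate a) n.
have [-> ->] := rotate_ReIm a n.
move: (complex.Re _) (complex.Im _) => u v.
rewrite !normrN opprK; case: (leP `|u| `|v|) => [h|/ltW h].
  have [v0|v0] := leP 0 v.
    by move: h; rewrite [`|v|]ger0_norm // => ->.
  by move: h; rewrite [`|v|]ltr0_norm // => ->; rewrite !orbT.
have [u0|u0] := leP 0 u.
  by move: h; rewrite [`|u|]ger0_norm // => ->; rewrite !orbT.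
by move: h; rewrite [`|u|]ltr0_norm // => ->; rewrite !orbT.
Qed.

Lemma admissible_summable a : admissible a ->
  exists C, forall M, \sum_(n < M) gap a n `^ beta <= C.
Proof.
move=> h0; have h1 := admissible_rotate h0; have h2 := admissible_rotate h1.
have h3 := admissible_rotate h2.
have [C0 hC0] := admissible_top h0; have [C1 hC1] := admissible_top h1.
have [C2 hC2] := admissible_top h2; have [C3 hC3] := admissible_top h3.
exists (C0 + C1 + C2 + C3) => M.
have p0 n : 0 <= gap a n `^ beta by exact: powR_ge0.
apply: le_trans (lerD (lerD (lerD (hC0 M) (hC1 M)) (hC2 M)) (hC3 M)).
rewrite ![\sum_(_ < _ | in_top _ _) _]big_mkcond -!big_split /=.
apply: ler_sum => n _; rewrite !gap_rotate; have := four_sectors a n.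
have := p0 n; move: (gap a n `^ beta) => g g0.
by case: (in_top a n); case: (in_top _ n); case: (in_top _ n); case: (in_top _ n) => // _; lra.
Qed.

End AllZeros.

Theorem theorem1 (R : realType) (alpha p : R)
    (halpha : -1 < alpha < - (1 / 2)) (hp : 3 / 2 + alpha < p <= 1)
    (a : nat -> R[i]^o) (ha : blaschke_sequence a)
    (hB : bergman_space p alpha (derive1 (blaschke a))) :
  forall beta : R, (2 - p + alpha) / (p - alpha - 1) < beta ->
    (\sum_(0 <= n <oo) ((1 - normc (a n)) `^ beta)%:E < +oo)%E.
Proof.
move=> beta hbeta; move: halpha hp => /andP[al1 al2] /andP[p1 p2].
set s := p - alpha - 1 in hbeta.
have s01 : 0 < s < 1 by apply/andP; split; rewrite /s; lra.
have p01 : 0 < p <= 1 by apply/andP; split; lra.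
have hbeta' : (1 - s) / s < beta.
  by rewrite (_ : 1 - s = 2 - p + alpha) // /s; ring.
have fin := bergman_mass p01 ha hB; rewrite -/s in fin.
set T := (\int[lebesgue_measure]_x _)%E in fin.
have T0 : (0 <= T)%E by apply: integral_ge0 => x _; exact: vertical_mass_ge0.
have Tfin : T \is a fin_num by rewrite ge0_fin_numE.
have adm : admissible s (fine T) a.
  split; first exact: ha.
    by move=> z z1; apply: derivable_ccontinuous; case: hB => an _; exact: an.
  by rewrite fineK.
have [C hC] := admissible_summable s01 (fine_ge0 T0) hbeta' adm.
apply: le_lt_trans (ltry C).
apply: lime_le.
  by apply: is_cvg_nneseries => n _ _; rewrite lee_fin powR_ge0.
by apply: nearW => M; rewrite sumEFin lee_fin big_mkord; exact: hC.
Qed.
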